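(* Let $G$ be a finitely generated group and let $N \trianglelefteq G$ be a normal subgroup such that $G/N$ is nilpotent. Then $N$ is finitely generated if and only if $S_{\mathrm{ord}}(G,N) \subseteq \Sigma^1_{\mathrm{ord}}(G)$.
   Context: An order on a group $G$ means a bi-invariant strict partial order: a relation $\prec$ on $G$ such that for all $f,g,h\in G$: not $g\prec g$; $g\prec h$ implies not $h\prec g$; $f\prec g$ and $g\prec h$ imply $f\prec h$; and $f\prec g$ implies $hf\prec hg$ and $fh\prec gh$. Write $g\preccurlyeq h$ if $g\prec h$ or $g=h$; $\succ,\succcurlyeq$ are the opposite relations. An element $g$ is positive if $1\prec g$. The order is trivial if $g\prec h$ holds for no pair $g,h$. A subset $S\subseteq G$ is an antichain if $s\prec t$ holds for no $s,t\in S$. Induced orders: if $\Phi\colon G\to Q$ is a group homomorphism and $\prec_Q$ is an order on $Q$, the order on $G$ induced by $\Phi$ (and $\prec_Q$) is given by $g\prec h \iff \Phi(g)\prec_Q\Phi(h)$. Properties of an order $\prec$ on $G$: It is archimedean if there are no $g,h\in G$ with $g$ positive and $g^i\prec h$ for all $i\in\mathbb{Z}$. It is primitive if for all $g,h\in G$ and $n\in\mathbb{N}$, $g^n\prec h^n$ implies $g\prec h$. It is factorizing if for every normal subgroup $H\trianglelefteq G$ that is an antichain, $\prec$ is induced by the projection $G\to G/H$ for some order on $G/H$. It is full if it is primitive and factorizing. Coarse connectedness: a subset $K\subseteq G$ of a group is coarsely connected if there exist a finitely generated subgroup $H\leqslant G$ containing $K$ and a finite generating set $S$ of $H$ such that the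 full subgraph of the Cayley graph $\mathrm{Cay}(H,S)$ spanned by $K$ (vertices the elements of $K$, edges all edges with both endpoints in $K$) is connected. The set $\Sigma^1_{\mathrm{ord}}(G)$ consists of those non-trivial full archimedean orders $\prec$ on $G$ such that for every antichain normal subgroup $K\trianglelefteq G$ that is maximal among antichain normal subgroups, the set $K_{\succcurlyeq}=\{g\in G\mid \exists k\in K\colon g\succcurlyeq k\}$ is coarsely connected. The set $S_{\mathrm{ord}}(G,N)$ consists of all orders on $G$ induced by the projection $\pi\colon G\to G/N$ from non-trivial full archimedean orders on $G/N$. *)

(* Defs.v *)
From HB Require Import structures.
From Stdlib Require Import Relation_Definitions Relation_Operators.
From mathcomp Require Import all_boot ssrint.
From mathcomp Require Import boolp classical_sets cardinality.

Set Implicit Arguments.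
Unset Strict Implicit.
Unset Printing Implicit Defensive.

Local Open Scope classical_set_scope.
Local Open Scope quotient_scope.
Local Open Scope group_scope.

Definition is_subgroup (G : groupType) (H : set G) : Prop :=
  [/\ H 1, forall x y, H x -> H y -> H (x * y) & forall x, H x -> H x^-1].

Definition is_normal_subgroup (G : groupType) (H : set G) : Prop :=
  is_subgroup H /\ forall x y, H x -> H (x ^ y).

Record normalSubgroup (G : groupType) := NormalSubgroup {
  nsg_set :> set G;
  nsg_normal : is_normal_subgroup nsg_set
}.

Definition generated (G : groupType) (S : set G) : set G :=
  smallest (@is_subgroup G) S.

Definition finitely_generated (G : groupType) (H : set G) : Prop :=
  exists2 S : set G, finite_set S & generated S = H.

(* lower_central G n is the (n+1)-st term of the lower central series. *)
Fixpoint lower_central (G : groupType) (n : nat) : set G :=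
  if n is n'.+1 then
    generated [set z | exists x y, lower_central n' x /\ z = [~ x, y]]
  else [set: G].

Definition nilpotent_group (G : groupType) : Prop :=
  exists n, @lower_central G n = [set 1].

Section QuotientGroup.
Variables (G : groupType) (N : normalSubgroup G).

Definition coset_rel (x y : G) : bool := `[< nsg_set N (x^-1 * y) >].

Lemma coset_rel_refl : reflexive coset_rel.
Proof.
by move=> x; apply/asboolP; rewrite mulVg; have [[]] := nsg_normal N.
Qed.

Lemma coset_rel_sym : symmetric coset_rel.
Proof.
have [[_ _ NV] _] := nsg_normal N.
suff sub x y : coset_rel x y -> coset_rel y x.
  by move=> x y; apply/idP/idP; apply: sub.
by move=> /asboolP /NV; rewrite invgM invgK => ?; apply/asboolP.
Qed.

Lemma coset_rel_trans : transitive coset_rel.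
Proof.
have [[_ NM _] _] := nsg_normal N.
move=> y x z /asboolP Nxy /asboolP Nyz; apply/asboolP.
by have := NM _ _ Nxy Nyz; rewrite mulgA mulgK.
Qed.

Canonical coset_equiv :=
  EquivRel coset_rel coset_rel_refl coset_rel_sym coset_rel_trans.

Definition quot := {eq_quot coset_equiv}.
HB.instance Definition _ := Choice.on quot.
HB.instance Definition _ := EqQuotient.on quot.

Definition quot_proj (x : G) : quot := \pi_quot x.

Lemma quot_projP x y : quot_proj x = quot_proj y <-> nsg_set N (x^-1 * y).
Proof.
split=> [/eqP|Nxy]; first by rewrite /quot_proj eqmodE => /asboolP.
by apply/eqP; rewrite /quot_proj eqmodE; apply/asboolP.
Qed.

Lemma quot_reprK u : quot_proj (repr u) = u.
Proof. exact: reprK. Qed.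

Definition quot_one : quot := quot_proj 1.
Definition quot_mul (u v : quot) : quot := quot_proj (repr u * repr v).
Definition quot_inv (u : quot) : quot := quot_proj (repr u)^-1.

Lemma quot_projM x y : quot_proj (x * y) = quot_mul (quot_proj x) (quot_proj y).
Proof.
have [[_ NM NV] NJ] := nsg_normal N.
apply/quot_projP; set x' := repr _; set y' := repr _.
have /quot_projP Nx : quot_proj x = quot_proj x' by rewrite quot_reprK.
have /quot_projP Ny : quot_proj y = quot_proj y' by rewrite quot_reprK.
have := NM _ _ (NJ _ y Nx) Ny.
by rewrite conjgE invgM !mulgA mulgK.
Qed.

Lemma quot_projV x : quot_proj x^-1 = quot_inv (quot_proj x).
Proof.
have [[_ NM NV] NJ] := nsg_normal N.
apply/quot_projP; set x' := repr _.
have /quot_projP Nx : quot_proj x' = quot_proj x by rewrite quot_reprK.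
have := NJ _ x'^-1 Nx.
by rewrite conjgE !invgK !mulgA mulgV mul1g.
Qed.

Lemma quot_mulA : associative quot_mul.
Proof.
move=> u v w; rewrite -[u]quot_reprK -[v]quot_reprK -[w]quot_reprK.
by rewrite -!quot_projM mulgA.
Qed.

Lemma quot_mul1 : left_id quot_one quot_mul.
Proof. by move=> u; rewrite -[u]quot_reprK -quot_projM mul1g. Qed.

Lemma quot_mulr1 : right_id quot_one quot_mul.
Proof. by move=> u; rewrite -[u]quot_reprK -quot_projM mulg1. Qed.

Lemma quot_mulV : left_inverse quot_one quot_inv quot_mul.
Proof.
by move=> u; rewrite -[u]quot_reprK -quot_projV -quot_projM mulVg.
Qed.

Lemma quot_mulrV : right_inverse quot_one quot_inv quot_mul.
Proof.
by move=> u; rewrite -[u]quot_reprK -quot_projV -quot_projM mulgV.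
Qed.

HB.instance Definition _ :=
  isGroup.Build quot quot_mulA quot_mul1 quot_mulr1 quot_mulV quot_mulrV.

HB.instance Definition _ :=
  isMultiplicative.Build G quot quot_proj quot_projM.

End QuotientGroup.

Definition zexpg (G : groupType) (g : G) (i : int) : G :=
  match i with Posz n => g ^+ n | Negz n => g ^- n.+1 end.

Record is_order (G : groupType) (r : relation G) : Prop := IsOrder {
  order_irrefl : forall g, ~ r g g;
  order_asym : forall g h, r g h -> ~ r h g;
  order_trans : forall f g h, r f g -> r g h -> r f h;
  order_mull : forall f g h, r f g -> r (h * f) (h * g);
  order_mulr : forall f g h, r f g -> r (f * h) (g * h)
}.

Section Orders.
Variable G : groupType.
Implicit Types (r : relation G) (S K : set G).

Definition trivial_order r : Prop := forall g h, ~ r g h.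

Definition antichain r S : Prop := forall s t, S s -> S t -> ~ r s t.

Definition induced (Q : groupType) (phi : {multiplicative G -> Q})
    (rQ : relation Q) : relation G :=
  fun g h => rQ (phi g) (phi h).

Definition archimedean r : Prop :=
  ~ exists g h, r 1 g /\ forall i : int, r (zexpg g i) h.

Definition primitive r : Prop :=
  forall g h (n : nat), r (g ^+ n) (h ^+ n) -> r g h.

Definition factorizing r : Prop :=
  forall H : normalSubgroup G, antichain r H ->
    exists2 rQ : relation (quot H), is_order rQ & r = induced (@quot_proj _ H) rQ.

Definition full r : Prop := primitive r /\ factorizing r.

Definition maximal_antichain_normal r (K : normalSubgroup G) : Prop :=
  antichain r K /\
  forall K' : normalSubgroup G, antichain r K' -> K `<=` K' -> K' `<=` K.

Definition upper_set r K : set G := [set g | exists2 k, K k & r k g \/ g = k].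

(* Edges of the Cayley graph are {x, x * s} with s in S. *)
Definition cayley_edge_in S K : relation G := fun x y =>
  [/\ K x, K y & exists2 s, S s & y = x * s].

(* Connecting paths may traverse edges in both directions. *)
Definition cayley_connected S K : Prop :=
  forall x y, K x -> K y -> clos_refl_sym_trans G (cayley_edge_in S K) x y.

Definition coarsely_connected K : Prop :=
  exists H S : set G, [/\ K `<=` H, finite_set S, generated S = H
                & cayley_connected S K].

End Orders.

Definition nontrivial_full_archimedean (G : groupType) : set (relation G) :=
  [set r | [/\ is_order r, ~ trivial_order r, full r & archimedean r]].

Definition Sigma1_ord (G : groupType) : set (relation G) :=
  [set r | nontrivial_full_archimedean r /\
    forall K : normalSubgroup G, maximal_antichain_normal r K ->
      coarsely_connected (upper_set r K)].

Definition S_ord (G : groupType) (N : normalSubgroup G) : set (relation G) :=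
  induced (@quot_proj _ N) @` @nontrivial_full_archimedean (quot N).

(* Main.v *)
Require Import Defs.
From HB Require Import structures.
From Stdlib Require Import Relation_Definitions Relation_Operators.
From mathcomp Require Import all_boot ssrint.
From mathcomp Require Import boolp classical_sets cardinality.

(** Write [M] for the preimage in [G] of the center of [G / H], where [H] is a
    normal subgroup with [G / H] nilpotent. The orders that matter have the
    following shape: [g < h] when [g^-1 * h] lies in [V] but not in [H], for a
    submonoid [V] with [V * H = V], [V] and its inverse covering [M] and meeting
    in [H]. Then [H] is the maximal antichain normal subgroup and [V] is its
    upper set, a half-space of [M].

    Suppose first that [N] is finitely generated. Passing to the quotient by a
    maximal antichain normal subgroup [K], which contains [N], every positive
    element is central ([positive_central]). Indeed, if [g > 1] is not central,
    commutators of [g] yield a central [z > 1] all of whose powers are ratios of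
    two products of conjugates of [g], of the same fixed length
    ([conj_ratio_comm]). Primitivity, applied to the square of [u * x], shows
    that a product of conjugates of [g] cannot have a much larger central lower
    bound than [g] itself ([conj_prod_extend]); comparing the two, [g] dominates
    all powers of [z], against the archimedean property. Hence the upper set of
    [K] is a half-space of the group [M] attached to [K], which is abelian
    modulo [K]. Both [K] and [M] are finitely generated ([fg_normal_over]), and
    reordering words shows that the half-space is coarsely connected
    ([central_monoid_coarsely_connected]).

    Conversely, suppose that [N] is not finitely generated, and let [H] be
    maximal among the normal subgroups containing [N] that are not. By
    maximality, [H] is generated by the conjugates of finitely many elements by
    the powers of any single [v] in [M] outside [H] ([maximal_fg_over_cyclic]).
    Say that [H] is finitely generated over a monoid [V] between [H] and [M] if
    it is generated by the conjugates of a finite set by products of finitely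
    many elements of [V]. By Zorn's lemma there is a largest [V] over which this
    fails. Since finite generation over both [V] with [u] and [V] with [u^-1]
    implies it over [V] ([fg_over_adjoin]), this [V] is a half-space, and
    [fg_over_infinitesimal] makes the resulting total order on [M / H]
    archimedean. In a nilpotent group with torsion-free center such an order on
    the center extends to a full archimedean order of the whole group
    ([cone_order_full_archimedean]), so that [V] is the upper set of [H] for an
    order in [S_ord N]. If [V] were coarsely connected, pushing its paths
    towards the interior of the half-space would make [H] finitely generated
    over [V] after all ([coarsely_connected_fg_over]). *)

Set Implicit Arguments.
Unset Strict Implicit.
Unset Printing Implicit Defensive.

Local Open Scope classical_set_scope.
Local Open Scope group_scope.

Ltac group_norm :=
  rewrite ?commgEl ?conjgE
    ?(invgM, invgK, invg1, mulgA, mulg1, mul1g, mulgV, mulVg, mulgK, mulgVK).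

(** * Finite sets and chains *)

Lemma finite_uniform_bound (T : Type) (A : set T) (P : nat -> T -> Prop) :
    finite_set A -> (forall m n x, (m <= n)%N -> P m x -> P n x) ->
    (forall x, A x -> exists n, P n x) ->
  exists n, forall x, A x -> P n x.
Proof.
elim/Pchoice: T => T in A P *.
move=> /finite_seqP[s ->] monoP; elim: s => [|a s IHs] exP.
  by exists 0%N => x; rewrite /= in_nil.
have [|n nP] := IHs; first by move=> x xs; apply: exP; rewrite /= inE xs orbT.
have [|m mP] := exP a; first by rewrite /= inE eqxx.
exists (maxn m n) => x; rewrite /= inE => /orP[/eqP->|xs].
  exact: monoP (leq_maxl _ _) mP.
exact: monoP (leq_maxr _ _) (nP x xs).
Qed.

Lemma finite_uniform_set (T U : Type) (A : set T) (V : set U)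
    (P : set U -> T -> Prop) :
    finite_set A -> (forall X Y x, X `<=` Y -> P X x -> P Y x) ->
    (forall x, A x -> exists X, [/\ finite_set X, X `<=` V & P X x]) ->
  exists X, [/\ finite_set X, X `<=` V & forall x, A x -> P X x].
Proof.
move=> finA monoP exP.
have /choice[F FP] x : exists X, A x -> [/\ finite_set X, X `<=` V & P X x].
  by case: (pselect (A x)) => [/exP[X XP]|nAx]; [exists X | exists set0].
exists (\bigcup_(x in A) F x); split.
- by apply: bigcup_finite => // x /FP[].
- by move=> u [x /FP[_ FV _] /FV].
- by move=> x Ax; have [_ _] := FP x Ax; apply: monoP => u Fu; exists x.
Qed.

Lemma Zorn_above (T : Type) (P : set (set T)) (N : set T) : P N ->
    (forall C, C !=set0 -> C `<=` P -> total_on C subset ->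
       P (\bigcup_(X in C) X)) ->
  exists A, [/\ P A, N `<=` A & forall B, P B -> A `<=` B -> B `<=` A].
Proof.
move=> PN chainP.
(* adding N to every set makes the union of the empty chain harmless *)
pose P' := [set A : set T | P (A `|` N)].
have [F FP' totF|A [PA maxA]] := @Zorn_bigcup T P'.
  have [->|/set0P F0] := eqVneq F set0; first by rewrite bigcup_set0 /P'/= set0U.
  rewrite /P'/=.
  suff -> : \bigcup_(X in F) X `|` N = \bigcup_(X in [set X `|` N | X in F]) X.
    apply: chainP; first by have [X FX] := F0; exists (X `|` N), X.
      by move=> _ [X FX <-]; apply: FP'.
    move=> _ _ [X FX <-] [Y FY <-].
    by have [XY|YX] := totF X Y FX FY; [left|right]; apply: setSU.
  apply/seteqP; split=> [x [[X FX Xx]|Nx]|x [_ [X FX <-] [Xx|Nx]]].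
  - by exists (X `|` N); first exists X; last left.
  - by have [X FX] := F0; exists (X `|` N); first exists X; last right.
  - by left; exists X.
  - by right.
exists (A `|` N); split=> // B PB AB.
apply: contrapT => nBA; apply: (maxA B); last first.
  rewrite /P'/=; suff -> : B `|` N = B by [].
  by apply/seteqP; split=> x; [case=> // Nx; apply: AB; right|left].
split; last by move=> BA; apply: nBA => x /BA; left.
by move=> x Ax; apply: AB; left.
Qed.

(** * Subgroups *)

Section Subgroups.
Variable G : groupType.
Implicit Types (E H N S B F : set G) (x y f v : G) (n : nat).

Lemma generated_group S : is_subgroup (generated S).
Proof.
split=> [E [[]]//|x y Sx Sy E EP|x Sx E EP].
  by have [[_ EM _] _] := EP; apply: EM; [apply: Sx|apply: Sy].
by have [[_ _ EV] _] := EP; apply: EV; apply: Sx.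
Qed.

Lemma sub_generated S : S `<=` generated S.
Proof. exact: sub_gen_smallest. Qed.

Lemma generated_min S E : is_subgroup E -> S `<=` E -> generated S `<=` E.
Proof. by move=> gE SE; apply: smallest_sub. Qed.

Lemma generated_mono S S' : S `<=` S' -> generated S `<=` generated S'.
Proof.
move=> SS'; apply: generated_min; first exact: generated_group.
by move=> x /SS'; apply: sub_generated.
Qed.

Lemma group_exp E x n : is_subgroup E -> E x -> E (x ^+ n).
Proof.
move=> [E1 EM _] Ex; elim: n => [|n IHn]; first by rewrite expg0.
by rewrite expgS; apply: EM.
Qed.

Lemma set1_group : is_subgroup [set 1 : G].
Proof.
split=> [//|x y -> ->|x ->]; first by rewrite /= mulg1.
by rewrite /= invg1.
Qed.

Lemma generated_normal S : (forall x y, S x -> generated S (x ^ y)) ->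
  is_normal_subgroup (generated S).
Proof.
move=> SJ; split=> [|x y]; first exact: generated_group.
move: x; have [E1 EM EV] := generated_group S.
apply: (@generated_min S [set x | generated S (x ^ y)]) => [|x Sx]; last exact: SJ.
split=> [|a b Ea Eb|a Ea] /=; first by rewrite conj1g.
  by rewrite conjMg; apply: EM.
by rewrite conjVg; apply: EV.
Qed.

Definition op_closed F E := forall f x, F f -> E x -> E (x ^ f^-1).

(** Conjugation is only allowed by the elements of [F], not by their inverses:
    this is what makes finite generation over a submonoid a meaningful notion. *)
Definition opgen B F : set G :=
  smallest (fun E => is_subgroup E /\ op_closed F E) B.

Lemma opgen_group B F : is_subgroup (opgen B F).
Proof.
split=> [E [[[]]]//|x y Sx Sy E EP|x Sx E EP].
  by have [[[_ EM _] _] _] := EP; apply: EM; [apply: Sx|apply: Sy].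
by have [[[_ _ EV] _] _] := EP; apply: EV; apply: Sx.
Qed.

Lemma opgen_closed B F : op_closed F (opgen B F).
Proof. by move=> f x Ff Ex E EP; have [[_ EF] _] := EP; apply: EF => //; apply: Ex. Qed.

Lemma sub_opgen B F : B `<=` opgen B F.
Proof. exact: sub_gen_smallest. Qed.

Lemma opgen_min B F E : is_subgroup E -> op_closed F E -> B `<=` E ->
  opgen B F `<=` E.
Proof. by move=> gE EF BE; apply: smallest_sub. Qed.

Lemma opgen_mono B B' F F' : B `<=` B' -> F `<=` F' ->
  opgen B F `<=` opgen B' F'.
Proof.
move=> BB' FF'; apply: opgen_min; first exact: opgen_group.
  by move=> f x /FF' ?; apply: opgen_closed.
by move=> x /BB'; apply: sub_opgen.
Qed.

Lemma preimage_conj_group E a : is_subgroup E ->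
  is_subgroup [set x | E (x ^ a)].
Proof.
move=> [E1 EM EV]; split=> [|x y Ex Ey|x Ex] /=; first by rewrite conj1g.
  by rewrite conjMg; apply: EM.
by rewrite conjVg; apply: EV.
Qed.

(** Conjugating by [a] a conjugate by [f] is conjugating by [f] a conjugate by
    [a], up to the commutator of [a] and [f]; so stability under conjugation by
    [a] can be tested on generators once these commutators belong to [E]. *)
Lemma opgen_conj B F E a : is_subgroup E -> op_closed F E ->
    (forall f, F f -> E (f ^ a^-1 * f^-1)) ->
    (forall b, B b -> E (b ^ a^-1)) ->
  forall x, opgen B F x -> E (x ^ a^-1).
Proof.
move=> gE EF EC EB.
apply: (@opgen_min B F [set x | E (x ^ a^-1)]) => //.
  exact: preimage_conj_group.
move=> f x Ff Ex; have [_ EM EV] := gE.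
rewrite /=.
have -> : (x ^ f^-1) ^ a^-1 =
    (f ^ a^-1 * f^-1) * (x ^ a^-1) ^ f^-1 * (f ^ a^-1 * f^-1)^-1.
  by group_norm.
apply: (EM); [apply: EM; [exact: EC|exact: EF]|exact/EV/EC].
Qed.

Lemma comm_pow E a f n : is_subgroup E -> (forall x, E x -> E (x ^ a)) ->
  E (f ^ a * f^-1) -> E (f ^ (a ^+ n) * f^-1).
Proof.
move=> [E1 EM EV] Ea Ef; elim: n => [|n IHn].
  by rewrite expg0 conjg1 mulgV.
have -> : f ^ (a ^+ n.+1) * f^-1 = (f ^ (a ^+ n) * f^-1) ^ a * (f ^ a * f^-1).
  by rewrite expgSr conjgM; move: (f ^ _) => y; group_norm.
by apply: EM => //; apply: Ea.
Qed.

Lemma conj_pow E a n x : (forall x, E x -> E (x ^ a)) -> E x -> E (x ^ (a ^+ n)).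
Proof.
move=> Ea Ex; elim: n => [|n IHn]; first by rewrite expg0 conjg1.
by rewrite expgSr conjgM; apply: Ea.
Qed.

End Subgroups.

(** * Maximal normal subgroups that are not finitely generated *)

Section MaximalNotFg.
Variable G : groupType.
Implicit Types (E H N S B F : set G) (x y f v : G) (n : nat).

Definition central_mod H : set G := [set g | forall h, H [~ g, h]].

Lemma central_comm H u g : is_normal_subgroup H -> central_mod H u ->
  H (g ^ u * g^-1).
Proof.
move=> [[_ _ HV] HJ] /(_ g) /HV Hu; have := HJ _ g^-1 Hu.
by rewrite invgR; group_norm.
Qed.

Lemma central_mod_group H : is_normal_subgroup H -> is_subgroup (central_mod H).
Proof.
move=> [[H1 HM HV] HJ]; split=> [h|x y Hx Hy h|x Hx h].
- by rewrite comm1g.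
- have -> : [~ x * y, h] = [~ x, h] ^ y * [~ y, h] by group_norm.
  by apply: HM => //; apply: HJ.
- have -> : [~ x^-1, h] = [~ x, h]^-1 ^ x^-1 by group_norm.
  by apply/HJ/HV.
Qed.

Lemma central_mod_normal H : is_normal_subgroup H ->
  is_normal_subgroup (central_mod H).
Proof.
move=> nH; have [_ HJ] := nH; split; first exact: central_mod_group.
move=> x y Hx h; have -> : [~ x ^ y, h] = [~ x, h ^ y^-1] ^ y.
  by rewrite conjRg conjgKV.
exact/HJ.
Qed.

Lemma sub_central_mod H : is_normal_subgroup H -> H `<=` central_mod H.
Proof.
move=> [[H1 HM HV] HJ] x Hx h; rewrite commgEl; apply: HM; first exact: HV.
exact: HJ.
Qed.

Definition maximal_not_fg H :=
  [/\ is_normal_subgroup H, ~ finitely_generated H &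
      forall K, is_normal_subgroup K -> H `<=` K -> ~ K `<=` H ->
        finitely_generated K].

Lemma chain_finite (T : Type) (C : set (set T)) (X : set T) :
    C !=set0 -> total_on C subset -> finite_set X -> X `<=` \bigcup_(Y in C) Y ->
  exists2 Y, C Y & X `<=` Y.
Proof.
elim/Pchoice: T => T in C X *.
move=> C0 totC /finite_seqP[s ->]; elim: s => [|a s IHs] sC.
  by have [Y CY] := C0; exists Y => // x; rewrite /= in_nil.
have [|Y CY sY] := IHs; first by move=> x xs; apply: sC; rewrite /= inE xs orbT.
have [|Z CZ Za] := sC a; first by rewrite /= inE eqxx.
have [YZ|ZY] := totC Y Z CY CZ; [exists Z|exists Y] => // x.
  by rewrite /= inE => /orP[/eqP->//|/sY/YZ].
by rewrite /= inE => /orP[/eqP->//|/sY]; first exact: ZY.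
Qed.

Lemma exists_maximal_not_fg N : is_normal_subgroup N -> ~ finitely_generated N ->
  exists2 H, maximal_not_fg H & N `<=` H.
Proof.
move=> nN nfN.
pose P := [set H : set G | is_normal_subgroup H /\ ~ finitely_generated H].
have [//|C C0 CP totC|H [[nH nfH] NH maxH]] := @Zorn_above G P N; last first.
  exists H => //; split=> // K nK HK nKH; apply: contrapT => nfK.
  by apply: nKH; apply: maxH.
have [X0 CX0] := C0.
split; first split; first split.
- by exists X0 => //; have [[[]]] := CP _ CX0.
- move=> x y [X CX Xx] [Y CY Yy].
  have [XY|YX] := totC X Y CX CY; [exists Y|exists X] => //.
    by have [[[_ YM _] _] _] := CP _ CY; apply: YM => //; apply: XY.
  by have [[[_ XM _] _] _] := CP _ CX; apply: XM => //; apply: YX.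
- by move=> x [X CX Xx]; exists X => //; have [[[_ _ XV] _] _] := CP _ CX; apply: XV.
- by move=> x y [X CX Xx]; exists X => //; have [[_ XJ] _] := CP _ CX; apply: XJ.
move=> [S finS SE].
have [|Y CY SY] := chain_finite C0 totC finS.
  by rewrite -SE; apply: sub_generated.
have [[gY _] nfY] := CP _ CY; apply: nfY; exists S => //.
apply/seteqP; split; first exact: generated_min.
by move=> x Yx; rewrite SE; exists Y.
Qed.

Lemma generated_cyclic_ext E v : is_subgroup E ->
    (forall x, E x -> E (x ^ v^-1)) ->
  generated (E `|` [set v]) `<=`
    [set x | exists i j, E (v ^+ i * x * v ^- j)].
Proof.
move=> [E1 EM EV] Ev.
have EvX n x : E x -> E (x ^ v ^- n).
  by move=> Ex; rewrite -expVgn; apply: conj_pow.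
apply: generated_min; last first.
  move=> x [Ex|->]; first by exists 0%N, 0%N; rewrite !expg0 invg1 mulg1 mul1g.
  by exists 0%N, 1%N; rewrite expg0 expg1 mul1g mulgV.
split=> [|x y [i [j Ex]] [k [l Ey]]|x [i [j Ex]]] /=.
- by exists 0%N, 0%N; rewrite !expg0 invg1 !mulg1.
- exists (k + i)%N, (j + l)%N.
  have := EM _ _ (EvX k _ Ex) (EvX j _ Ey).
  congr (E _); rewrite !expgnDr; group_norm.
  have cvv : v ^- j * v ^- k = v ^- k * v ^- j by rewrite -!invgM -!expgnDr addnC.
  have -> (a b : G) : a * v ^- j * v ^- k * b = a * (v ^- j * v ^- k) * b.
    by rewrite !mulgA.
  by rewrite cvv; group_norm.
- by exists j, i; have := EV _ Ex; rewrite !invgM invgK mulgA.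
Qed.

(** The subgroup of all exponents [n] with [v ^+ n] in [H] is cyclic. *)
Lemma torsion_generator H v : is_subgroup H ->
  exists B, [/\ finite_set B, B `<=` H &
    forall n, H (v ^+ n) -> generated B (v ^+ n)].
Proof.
move=> gH; have [H1 HM HV] := gH.
have [[m [m0 Hm]]|nt] := pselect (exists m, (0 < m)%N /\ H (v ^+ m)); last first.
  exists set0; split=> // n Hn.
  case: n Hn => [|n] Hn; last by case: nt; exists n.+1.
  by rewrite expg0; have [] := generated_group (set0 : set G).
pose P k := (0 < k)%N && `[< H (v ^+ k) >].
have exP : exists k, P k by exists m; apply/andP; split=> //; apply/asboolP.
case: (ex_minnP exP) => {m0 Hm}m /andP[m0 /asboolP Hm] minm.
exists [set v ^+ m]; split; first exact: finite_set1.
  by move=> _ ->.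
move=> n Hn; rewrite (divn_eq n m).
have Hr : H (v ^+ (n %% m)).
  have := HM _ _ (HV _ (group_exp (n %/ m) gH Hm)) Hn.
  by rewrite {2}(divn_eq n m) expgnDr -expgnA [(m * _)%N]mulnC mulKg.
have r0 : (n %% m = 0)%N.
  apply/eqP; rewrite -leqn0 leqNgt; apply/negP => r0.
  have := minm (n %% m)%N; rewrite /P r0 => /(_ (introT (asboolP _) Hr)).
  by rewrite leqNgt ltn_mod m0.
rewrite r0 addn0 mulnC expgnA.
apply: (group_exp _ (generated_group _)).
exact: sub_generated.
Qed.

(** [<H, v>] is normal because [v] is central modulo [H], hence finitely
    generated by maximality; up to powers of [v] its generators lie in [H]. *)
Lemma maximal_fg_over_cyclic H v : maximal_not_fg H -> central_mod H v -> ~ H v ->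
  exists B, [/\ finite_set B, B `<=` H & H `<=` opgen B [set v; v^-1]].
Proof.
move=> [nH _ maxH] Zv nHv; have [gH HJ] := nH; have [H1 HM HV] := gH.
pose K := generated (H `|` [set v]).
have gK : is_subgroup K by exact: generated_group.
have HK : H `<=` K by move=> x Hx; apply: sub_generated; left.
have Kv : K v by apply: sub_generated; right.
have [S finS SE] : finitely_generated K.
  apply: maxH => //; last by move/(_ v Kv).
  apply: generated_normal => x y [Hx|->]; first by apply: HK; apply: HJ.
  have -> : v ^ y = v * [~ v, y] by group_norm.
  by have [_ KM _] := gK; apply: KM => //; apply: HK.
have KS : forall s, exists ij : nat * nat, S s -> H (v ^+ ij.1 * s * v ^- ij.2).
  move=> s; have [Ss|] := pselect (S s); last by exists (0%N, 0%N).
  have Ks : K s by rewrite -SE; apply: sub_generated.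
  have [|i [j Hij]] := generated_cyclic_ext gH _ Ks; first by move=> x; apply: HJ.
  by exists (i, j).
have [f fP] := choice KS.
pose r s := v ^+ (f s).1 * s * v ^- (f s).2.
have [B0 [finB0 B0H B0P]] := torsion_generator v gH.
exists (r @` S `|` B0); split.
- by rewrite finite_setU; split=> //; apply: finite_image.
- by move=> x [[s Ss <-]|/B0H//]; apply: fP.
set E := opgen _ _.
have gE : is_subgroup E by exact: opgen_group.
have [E1 EM EV] := gE.
have Ev x : E x -> E (x ^ v^-1) by apply: opgen_closed; left.
have EvV x : E x -> E (x ^ v).
  by move=> Ex; rewrite -[v]invgK; apply: opgen_closed => //; right.
have KE : K `<=` [set x | exists i j, E (v ^+ i * x * v ^- j)].
  suff KEv : K `<=` generated (E `|` [set v]).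
    by move=> x /KEv; apply: generated_cyclic_ext.
  rewrite -SE; apply: generated_min; first exact: generated_group.
  have [L1 LM LV] := generated_group (E `|` [set v]).
  have Lv : generated (E `|` [set v]) v by apply: sub_generated; right.
  move=> s Ss; have -> : s = v ^- (f s).1 * r s * v ^+ (f s).2.
    by rewrite /r; group_norm.
  apply: (LM); first apply: LM.
  - exact: (LV _ (group_exp _ (generated_group _) Lv)).
  - by apply: sub_generated; left; apply: sub_opgen; left; exists s.
  - exact: (group_exp _ (generated_group _) Lv).
move=> x Hx; have [i [j Eij]] := KE x (HK x Hx).
(* conjugating back, x is known up to a power of v, which then lies in H *)
have {}Eij : E (x * (v ^- j * v ^+ i)).
  have := conj_pow i EvV Eij; congr (E _).
  by group_norm.
have EB0 n : H (v ^+ n) -> E (v ^+ n).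
  move=> /B0P; apply: generated_min => // b B0b; apply: sub_opgen; right.
  by [].
have EH : E `<=` H.
  apply: opgen_min => // [g y _|y [[s Ss <-]|/B0H//]]; first exact: HJ.
  exact: fP.
have Hp : H (v ^- j * v ^+ i).
  by rewrite -(mulKg x (_ * _)); apply: HM; [exact: HV|exact: EH].
suff Ep : E (v ^- j * v ^+ i).
  by rewrite -(mulgK (v ^- j * v ^+ i) x); apply: EM => //; apply: EV.
have [le_ij|/ltnW le_ij] := leqP i j.
  have ji : v ^- j * v ^+ i = v ^- (j - i).
    by rewrite -{1}(subnKC le_ij) expgnDr invgM mulgVK.
  rewrite ji in Hp *; apply: EV; apply: EB0.
  by have := HV _ Hp; rewrite invgK.
have ji : v ^- j * v ^+ i = v ^+ (i - j) by rewrite -{1}(subnKC le_ij) expgnDr mulKg.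
by rewrite ji in Hp *; apply: EB0.
Qed.

End MaximalNotFg.

(** * Nilpotent groups *)

Section Nilpotent.
Variable P : groupType.
Implicit Types (H U : set P) (x y g h : P) (i n : nat).

Fixpoint upper_central n : set P :=
  if n is n'.+1 then central_mod (upper_central n') else [set 1].

Lemma upper_central_normal n : is_normal_subgroup (upper_central n).
Proof.
elim: n => [|n IHn] /=; last exact: central_mod_normal.
by split=> [|x y -> /=]; [exact: set1_group|rewrite conj1g].
Qed.

Lemma nilpotent_upper_central : nilpotent_group P ->
  exists n, forall x, upper_central n x.
Proof.
move=> [c lc1]; exists c => x.
suff lcs j : (j <= c)%N -> @lower_central P (c - j) `<=` upper_central j.
  by apply: (lcs c) => //; rewrite subnn.
elim: j => [|j IHj] jc; first by rewrite subn0 lc1.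
move=> z lz h; apply: (IHj (ltnW jc)).
by rewrite -(subnSK jc) /=; apply: sub_generated; exists z, h.
Qed.

(** Commutators of elements of [H] stay in [H] and descend the upper central
    series, so their last nontrivial value is central. *)
Lemma nilpotent_normal_center H : nilpotent_group P -> is_normal_subgroup H ->
    (forall x, H x -> central_mod [set 1] x -> x = 1) ->
  forall x, H x -> x = 1.
Proof.
move=> /nilpotent_upper_central[n ucn] [[_ HM HV] HJ] HZ x Hx.
suff HU m y : H y -> upper_central m y -> y = 1 by apply: (HU n).
elim: m y => [|m IHm] // y Hy Uy; apply: HZ => // h.
apply: IHm => //; rewrite commgEl; apply: HM; [exact: HV|exact: HJ].
Qed.

Lemma nilpotent_engel : nilpotent_group P ->
  exists c, forall x y, iter c (fun w => [~ w, y]) x = 1.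
Proof.
move=> [c lc1]; exists c => x y.
suff: lower_central c (iter c (fun w => [~ w, y]) x) by rewrite lc1.
elim: c {lc1} => //= c IHc.
by apply: sub_generated; exists (iter c (fun w => [~ w, y]) x), y.
Qed.

Lemma comm_expl U x y n : is_normal_subgroup U -> central_mod U [~ x, y] ->
  U ([~ x ^+ n, y]^-1 * [~ x, y] ^+ n).
Proof.
move=> nU Zc; have [[U1 UM UV] UJ] := nU.
elim: n => [|n IHn]; first by rewrite !expg0 comm1g invg1 mulg1.
rewrite !expgS.
have -> : [~ x * x ^+ n, y] = [~ x, y] ^ (x ^+ n) * [~ x ^+ n, y] by group_norm.
set c := [~ x, y]; set b := [~ x ^+ n, y].
have -> : (c ^ (x ^+ n) * b)^-1 * (c * c ^+ n) =
   ((c ^ (x ^+ n))^-1 * c) ^ b * (b^-1 * c ^+ n) by group_norm.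
apply: UM => //; apply: UJ.
by have /UV := Zc (x ^+ n); rewrite commgEl invgM invgK.
Qed.

Hypothesis torsionfree_center :
  forall (z : P) n, central_mod [set 1] z -> (0 < n)%N -> z ^+ n = 1 -> z = 1.

(** Modulo the next lower term of the series, taking powers commutes with
    taking commutators; this carries torsion-freeness up from the center. *)
Lemma upper_central_isolated i g n : (0 < n)%N -> upper_central i.+1 g ->
  upper_central i (g ^+ n) -> upper_central i g.
Proof.
move=> n0; elim: i g => [|i IHi] g Zg Zgn; first exact: torsionfree_center Zgn.
move=> h; apply: IHi; first exact: Zg.
have [[_ UM _] _] := upper_central_normal i.
have := UM _ _ (Zgn h) (comm_expl n (upper_central_normal i) (Zg h)).
by rewrite mulVKg.
Qed.

Hypothesis nilP : nilpotent_group P.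

Lemma commute_root x y n : (0 < n)%N -> [~ x ^+ n, y] = 1 -> [~ x, y] = 1.
Proof.
move=> n0 xny; have [m ucm] := nilpotent_upper_central nilP.
elim: m {ucm}(ucm [~ x, y]) => [|m IHm] // Zc; apply: IHm.
apply: (upper_central_isolated n0 Zc).
by have := comm_expl n (upper_central_normal m) Zc; rewrite xny invg1 mul1g.
Qed.

(** [h ^+ n] differs from [g ^+ n] by a central element, hence commutes with
    [g]; by uniqueness of roots [h] commutes with [g], so that [g^-1 * h] has a
    central power. *)
Lemma central_root g h n : (0 < n)%N -> central_mod [set 1] ((g ^+ n)^-1 * h ^+ n) ->
  central_mod [set 1] (g^-1 * h).
Proof.
move=> n0 Zz; have hn : h ^+ n = g ^+ n * ((g ^+ n)^-1 * h ^+ n) by rewrite mulVKg.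
have cgh : commute g h.
  apply/esym/commgP/eqP; apply: (commute_root n0).
  apply/eqP/commgP; rewrite hn; apply/commute_sym/commuteM.
    exact/commuteX/commute_refl.
  by apply/commute_sym/commgP/eqP/Zz.
move=> y; apply: (commute_root n0).
rewrite expgMn; last by apply/commute_sym/commuteV/commute_sym.
by rewrite expVgn; apply: Zz.
Qed.

End Nilpotent.

(** * Quotients *)

(* The projection sends 1 to 1 by definition of the unit of the quotient. *)
HB.instance Definition _ (G : groupType) (N : normalSubgroup G) :=
  Multiplicative_isUMagmaMorphism.Build G (quot N) (@quot_proj G N) erefl.

Section Quotients.
Variables (G : groupType) (N : normalSubgroup G).
Notation pi := (@quot_proj G N).

Lemma quot_proj1P x : pi x = 1 <-> nsg_set N x.
Proof.
have <- : pi 1 = 1 by exact: gmulf1.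
split=> [/esym/quot_projP|Nx]; first by rewrite invg1 mul1g.
by apply/esym/quot_projP; rewrite invg1 mul1g.
Qed.

Lemma central_quot x : central_mod [set 1] (pi x) <-> central_mod N x.
Proof.
split=> [Zx h|Zx u]; first by apply/quot_proj1P; rewrite gmulfR; apply: Zx.
by rewrite -(quot_reprK u) -gmulfR; apply/quot_proj1P/Zx.
Qed.

Lemma lower_central_quot n x : lower_central n x -> lower_central n (pi x).
Proof.
elim: n x => // n IHn; apply: generated_min.
  have [L1 LM LV] := generated_group
    [set z : quot N | exists x y, lower_central n x /\ z = [~ x, y]].
  split=> [|x y Lx Ly|x Lx]; rewrite /= ?gmulf1 ?gmulfM ?gmulfV //.
    exact: LM.
  exact: LV.
move=> _ [x [y [Lx ->]]]; rewrite /= gmulfR; apply: sub_generated.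
by exists (pi x), (pi y); split=> //; apply: IHn.
Qed.

Lemma quot_lower_central n u : lower_central n u ->
  exists2 x, lower_central n x & pi x = u.
Proof.
elim: n u => [|n IHn]; first by move=> u _; exists (repr u); rewrite ?quot_reprK.
apply: generated_min.
  have [L1 LM LV] := generated_group
    [set z : G | exists x y, lower_central n x /\ z = [~ x, y]].
  split=> [|_ _ [x Lx <-] [y Ly <-]|_ [x Lx <-]].
  - by exists 1; rewrite ?gmulf1.
  - by exists (x * y); rewrite ?gmulfM //; apply: LM.
  - by exists x^-1; rewrite ?gmulfV //; apply: LV.
move=> _ [u [v [/IHn[x Lx <-] ->]]]; exists [~ x, repr v].
  by apply: sub_generated; exists x, (repr v).
by rewrite gmulfR /= quot_reprK.
Qed.

End Quotients.

Lemma nilpotent_quot_sub (G : groupType) (N K : normalSubgroup G) :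
  N `<=` K -> nilpotent_group (quot N) -> nilpotent_group (quot K).
Proof.
move=> NK [c lc1]; exists c; apply/seteqP; split=> [u|_ ->]; last first.
  by case: c {lc1} => // c; have [] := generated_group
    [set z : quot K | exists x y, lower_central c x /\ z = [~ x, y]].
move=> /quot_lower_central[x /(lower_central_quot N)].
by rewrite lc1 => /quot_proj1P/NK/quot_proj1P -> <-.
Qed.

Section FgExtension.
Variable G : groupType.
Implicit Types (H : set G) (N : normalSubgroup G).

Lemma maximal_not_fg_central H (nH : is_normal_subgroup H) :
    finitely_generated [set: G] -> nilpotent_group (quot (NormalSubgroup nH)) ->
    ~ finitely_generated H ->
  exists2 v, central_mod H v & ~ H v.
Proof.
move=> fgG nilH nfH; apply: contrapT => nZ; apply: nfH.
suff -> : H = [set: G] by [].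
apply/seteqP; split=> // x _; apply/(quot_proj1P (NormalSubgroup nH)).
apply: (nilpotent_normal_center nilH (H := [set: _])) => // u _.
rewrite -(quot_reprK u) => /central_quot Zu; apply/quot_proj1P.
by apply: contrapT => nHu; apply: nZ; exists (repr u).
Qed.

(** A maximal counterexample [K] is generated by the conjugates of finitely many
    elements [b] by the powers of one element [v]. By nilpotency the iterated
    commutators of [b] with [v] end in [N], so that [N] and finitely many of
    them generate a subgroup stable under conjugation by [v] and [v^-1]. *)
Lemma fg_normal_over N H : finitely_generated [set: G] ->
    nilpotent_group (quot N) -> finitely_generated N ->
    is_normal_subgroup H -> N `<=` H -> finitely_generated H.
Proof.
move=> fgG nilN [S finS SE] nH0 NH0; apply: contrapT.
move=> /(exists_maximal_not_fg nH0)[{nH0}K maxK HK].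
have {NH0 HK}NK : N `<=` K by move=> x /NH0/HK.
have [nK nfK _] := maxK; have [[K1 KM KV] KJ] := nK.
have nilK := nilpotent_quot_sub (K := NormalSubgroup nK) NK nilN.
have [v Zv nKv] := maximal_not_fg_central fgG nilK nfK.
have [B [finB BK KE]] := maximal_fg_over_cyclic maxK Zv nKv.
have [c cN] := nilpotent_engel nilN.
pose it j b := iter j (fun w => [~ w, v]) b.
have itS j b : it j.+1 b = (it j b)^-1 * it j b ^ v by [].
have itN b : nsg_set N (it c b).
  apply/quot_proj1P; rewrite -[RHS](cN (quot_proj N b) (quot_proj N v)).
  by rewrite /it; elim: (c) => //= j <-; rewrite gmulfR.
have [[_ NM NV] NJ] := nsg_normal N.
have itNj j b : (c <= j)%N -> nsg_set N (it j b).
  move=> cj; rewrite -(subnK cj) addnC; elim: (j - c)%N => [|k IHk].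
    by rewrite addn0.
  by rewrite addnS itS; apply: NM; [apply: NV|apply: NJ].
have itK j b : K b -> K (it j b).
  move=> Kb; elim: j => // j IHj; rewrite itS.
  by apply: KM; [apply: KV|apply: KJ].
pose L := [set it j b | j in `I_c & b in B].
have finL : finite_set L by apply: finite_image2 => //; apply: finite_II.
apply: nfK; exists (S `|` L); first by rewrite finite_setU.
set E := generated _; have gE : is_subgroup E by apply: generated_group.
have [E1 EM EV] := gE.
have NE : N `<=` E by rewrite -SE; apply: generated_mono => x; left.
have SN x : S x -> nsg_set N x by move=> Sx; rewrite -SE; apply: sub_generated.
have itE j b : B b -> E (it j b).
  move=> Bb; have [jc|cj] := ltnP j c.
    by apply: sub_generated; right; exists j => //; exists b.
  by apply: NE; apply: itNj.
have itV j b : B b -> E (it j b ^ v^-1).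
  move=> Bb; move: {2}(c - j)%N (leqnn (c - j)) => k.
  elim: k j => [|k IHk] j jk.
    by apply: NE; apply: NJ; apply: itNj; rewrite -subn_eq0 -leqn0.
  have -> : it j b ^ v^-1 = it j b * ((it j.+1 b) ^ v^-1)^-1.
    by rewrite itS; move: (it j b) => w; group_norm.
  apply: EM; first exact: itE.
  by apply: EV; apply: IHk; move: jk; rewrite !leq_subLR addSnnS.
have Ev x : E x -> E (x ^ v).
  move: x; apply: (generated_min (preimage_conj_group v gE)) => x [/SN/NJ Nx|].
    exact: NE (Nx _).
  move=> [j _ [b Bb <-]] /=.
  have -> : it j b ^ v = it j b * it j.+1 b by rewrite itS mulVKg.
  by apply: EM; apply: itE.
have EvV x : E x -> E (x ^ v^-1).
  move: x; apply: (generated_min (preimage_conj_group v^-1 gE)) => x [/SN/NJ Nx|].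
    exact: NE (Nx _).
  by move=> [j _ [b Bb <-]] /=; apply: itV.
apply/seteqP; split.
  apply: generated_min => // x [/SN/NK//|[j _ [b /BK Bb <-]]].
  exact: itK.
move=> x /KE; apply: opgen_min => // [f y [->|->]|b Bb].
- exact: EvV.
- by rewrite invgK; apply: Ev.
- exact: (itE 0%N).
Qed.

End FgExtension.

(** * Finite generation over a submonoid *)

Section FgOver.
Variable G : groupType.
Implicit Types (E H V B F : set G) (x y u v f : G) (m n : nat).

(** [V] plays the role of a half-space: for [V = H] this is finite generation
    of [H], and the condition weakens as [V] grows. *)
Definition fg_over H V := exists B F,
  [/\ finite_set B, finite_set F, B `<=` H, F `<=` V & H `<=` opgen B F].

Definition central_monoid H V :=
  [/\ forall x y, V x -> V y -> V (x * y), H `<=` V & V `<=` central_mod H].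

Definition adjoin V u := [set x | exists v n, V v /\ x = v * u ^+ n].

Lemma fg_over_self H : is_subgroup H -> fg_over H H -> finitely_generated H.
Proof.
move=> gH [B [F [finB finF BH FH HE]]].
exists (B `|` F); first by rewrite finite_setU.
apply/seteqP; split; first by apply: generated_min => // x [/BH|/FH].
have [L1 LM LV] := generated_group (B `|` F).
move=> x /HE; apply: opgen_min => // [f y Ff Ly|b Bb]; last first.
  by apply: sub_generated; left.
have Lf : generated (B `|` F) f by apply: sub_generated; right.
by group_norm; apply: (LM); [exact: LM|exact: LV].
Qed.

Lemma adjoin_fg_over H V u : V 1 -> fg_over H (adjoin V u) -> exists B F,
  [/\ finite_set B, finite_set F, B `<=` H, F `<=` V &
      H `<=` opgen B (F `|` [set u])].
Proof.
move=> V1 [B [F [finB finF BH FV HE]]].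
have /choice[w wP] f : exists v, F f -> V v /\ exists n, f = v * u ^+ n.
  have [/FV[v [n [Vv ->]]]|nFf] := pselect (F f); last by exists 1.
  by exists v => _; split=> //; exists n.
exists B, (w @` F); split=> //; first exact: finite_image.
  by move=> _ [f /wP[Vf _] <-].
move=> x /HE; apply: opgen_min; first exact: opgen_group.
  move=> f y Ff Ey; have [_ [n ->]] := wP f Ff.
  rewrite invgM conjgM; apply: opgen_closed; first by left; exists f.
  by rewrite -expVgn; apply: conj_pow Ey => z; apply: opgen_closed; right.
exact: sub_opgen.
Qed.

(** The subgroups [Eq q] generated over [F] by the conjugates [b ^ u^-i] with
    [i <= q] increase to [H]. As soon as one of them contains the finitely many
    elements [b ^ u], it is stable under conjugation by [u], and its conjugates
    by the powers of [u^-1] exhaust [H]. *)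
Lemma opgen_absorbing H F u B : is_normal_subgroup H ->
    finite_set B -> B `<=` H -> H `<=` opgen B (F `|` [set u]) ->
    (forall f, F f -> B (f ^ u^-1 * f^-1)) -> (forall f, F f -> B (f ^ u * f^-1)) ->
  exists B', [/\ finite_set B', B `<=` B', B' `<=` H,
    forall x, opgen B' F x -> opgen B' F (x ^ u) &
    forall h, H h -> exists m, opgen B' F (h ^ (u ^+ m))].
Proof.
move=> [gH HJ] finB BH HE cu cuV.
pose Bq q := [set b ^ (u^-1 ^+ i) | i in `I_q.+1 & b in B].
have BBq q : B `<=` Bq q.
  by move=> b Bb; exists 0%N => //; exists b => //; rewrite expg0 conjg1.
have Bqmono p q : (p <= q)%N -> Bq p `<=` Bq q.
  move=> pq _ [i ip [b Bb <-]]; exists i; last by exists b.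
  exact: leq_trans ip _.
pose Eq q := opgen (Bq q) F.
have gE q : is_subgroup (Eq q) by exact: opgen_group.
have Emono p q : (p <= q)%N -> Eq p `<=` Eq q.
  by move=> /Bqmono ?; apply: opgen_mono.
have EB q b : B b -> Eq q b by move=> Bb; apply: sub_opgen; apply: BBq.
have Eu q x : Eq q x -> Eq q.+1 (x ^ u^-1).
  move: x; apply: opgen_conj => //; first exact: opgen_closed.
    by move=> f Ff; (apply: EB; exact: cu).
  move=> _ [i iq [b Bb <-]]; apply: sub_opgen; exists i.+1 => //.
  by exists b => //; rewrite expgSr conjgM.
have HU h : H h -> exists q, Eq q h.
  move=> /HE; apply: (@opgen_min _ _ _ [set h | exists q, Eq q h]).
  - split=> [|x y [p Ex] [q Ey]|x [q Ex]]; first by exists 0%N; have [] := gE 0%N.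
      exists (maxn p q); have [_ EM _] := gE (maxn p q); apply: EM.
        exact: Emono (leq_maxl _ _) _ Ex.
      exact: Emono (leq_maxr _ _) _ Ey.
    by exists q; have [_ _ EV] := gE q; apply: EV.
  - move=> f x [Ff|->] [q Ex]; last by exists q.+1; apply: Eu.
    by exists q; apply: opgen_closed.
  - by move=> b Bb; exists 0%N; apply: EB.
have [k kP] : exists k, forall b, B b -> Eq k (b ^ u).
  apply: (@finite_uniform_bound _ B (fun k b => Eq k (b ^ u))) => //.
    by move=> m n x /Emono mn; apply: mn.
  by move=> b /BH Hb; apply: HU; apply: HJ.
have Ek x : Eq k x -> Eq k (x ^ u).
  rewrite -[in X in _ -> X](invgK u).
  move: x; apply: opgen_conj => //; first exact: opgen_closed.
    by move=> f Ff; rewrite invgK; (apply: EB; exact: cuV).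
  move=> _ [[|i] ik [b Bb <-]]; first by rewrite expg0 conjg1 invgK; apply: kP.
  apply: sub_opgen; exists i; first exact: ltnW.
  by exists b => //; rewrite expgSr conjgM invgK conjgKV.
exists (Bq k); split=> //.
- exact/finite_image2.
- by move=> _ [i _ [b Bb <-]]; apply: HJ; apply: BH.
have [_ EM EV] := gE k.
move=> h /HE; apply: (@opgen_min _ _ _ [set h | exists m, Eq k (h ^ (u ^+ m))]).
- have Eup m n x : (m <= n)%N -> Eq k (x ^ (u ^+ m)) -> Eq k (x ^ (u ^+ n)).
    by move=> mn Ex; rewrite -(subnKC mn) expgnDr conjgM; exact: conj_pow Ek Ex.
  split=> [|x y [p Ex] [q Ey]|x [q Ex]].
  + by exists 0%N; rewrite conj1g; have [] := gE k.
  + exists (maxn p q); rewrite conjMg; apply: EM.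
      exact: Eup (leq_maxl _ _) Ex.
    exact: Eup (leq_maxr _ _) Ey.
  + by exists q; rewrite conjVg; apply: EV.
- move=> f x [Ff|->] [m Ex]; last by exists m.+1; rewrite expgS conjgM conjgKV.
  exists m; have -> : (x ^ f^-1) ^ (u ^+ m) =
      (f ^ (u ^+ m) * f^-1) * (x ^ (u ^+ m)) ^ f^-1 * (f ^ (u ^+ m) * f^-1)^-1.
    by group_norm.
  have Ef := comm_pow m (gE k) Ek (EB k _ (cuV f Ff)).
  by apply: (EM); [apply: EM => //; apply: opgen_closed|apply: EV].
- by move=> b Bb; exists 0%N; rewrite expg0 conjg1; apply: EB.
Qed.

(** The subgroup absorbing [H] under powers of [u] and the one absorbing [H]
    under powers of [u^-1] absorb each other; the second one is therefore all
    of [H]. *)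
Lemma fg_over_adjoin H V u : is_normal_subgroup H -> central_monoid H V ->
    central_mod H u -> fg_over H (adjoin V u) -> fg_over H (adjoin V u^-1) ->
  fg_over H V.
Proof.
move=> nH [VM HV VZ] Zu; have [gH HJ] := nH; have [H1 HM HVi] := gH.
have V1 : V 1 by exact: HV.
move=> /(adjoin_fg_over V1)[B1 [F1 [finB1 finF1 B1H F1V HE1]]].
move=> /(adjoin_fg_over V1)[B2 [F2 [finB2 finF2 B2H F2V HE2]]].
have ZuV : central_mod H u^-1 by have [_ _] := central_mod_group nH; apply.
pose F := F1 `|` F2.
pose B := (B1 `|` B2) `|`
  ([set f ^ u * f^-1 | f in F] `|` [set f ^ u^-1 * f^-1 | f in F]).
have finF : finite_set F by rewrite finite_setU.
have finB : finite_set B by rewrite !finite_setU; do !split=> //; apply: finite_image.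
have BH : B `<=` H.
  move=> _ [[/B1H|/B2H]//|[[f _ <-]|[f _ <-]]]; exact: central_comm.
have c1 f : F f -> B (f ^ u * f^-1) by move=> Ff; right; left; exists f.
have c2 f : F f -> B (f ^ u^-1 * f^-1) by move=> Ff; right; right; exists f.
have HE : H `<=` opgen B (F `|` [set u]).
  move=> x /HE1; apply: opgen_mono => b; first by left; left.
  by case=> ?; [left; left|right].
have HE' : H `<=` opgen B (F `|` [set u^-1]).
  move=> x /HE2; apply: opgen_mono => b; first by left; right.
  by case=> ?; [left; right|right].
have [B' [finB' BB' B'H Bu HU]] := opgen_absorbing nH finB BH HE c2 c1.
have [|C [finC BC CH Cu CU]] := opgen_absorbing nH finB BH HE' _ c2.
  by move=> f Ff; rewrite invgK; apply: c1.
exists C, F; split=> //; first by move=> f [/F1V|/F2V].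
have [m mP] : exists m, forall b, B' b -> opgen C F (b ^ (u^-1 ^+ m)).
  apply: (@finite_uniform_bound _ _ (fun m b => opgen C F (b ^ (u^-1 ^+ m)))) => //.
    by move=> p q x pq Ex; rewrite -(subnKC pq) expgnDr conjgM; exact: conj_pow Cu Ex.
  by move=> b /B'H/CU.
move=> h Hh; have [p hp] := HU h Hh.
have {}hp : opgen B' F (h ^ (u ^+ (p + m))).
  by rewrite expgnDr conjgM; exact: conj_pow Bu hp.
have gC := opgen_group C F.
suff BC' x : opgen B' F x -> opgen C F (x ^ (u^-1 ^+ (p + m))).
  by have := BC' _ hp; rewrite expVgn conjgK.
rewrite expVgn; move: x; apply: opgen_conj => //; first exact: opgen_closed.
  move=> f Ff; rewrite -expVgn; apply: (comm_pow _ gC Cu).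
  by apply: sub_opgen; (apply: BC; exact: c2).
move=> b /mP bm; rewrite addnC -expVgn expgnDr conjgM; exact: conj_pow Cu bm.
Qed.

Lemma generated1_commute x p : generated [set x] p -> commute x p.
Proof.
move: p; apply: (@generated_min _ _ [set p | commute x p]) => [|_ ->//].
split=> [|p q|p] /=; first exact: commute1.
  exact: commuteM.
exact: commuteV.
Qed.

(** Conjugation by [y] carries the finitely many generators of [H] into
    conjugates by finitely many powers of [x]; as [y] dominates these powers,
    the conjugators can be shifted back into [V]. *)
Lemma fg_over_infinitesimal H V x y B : is_normal_subgroup H ->
    central_monoid H V -> central_mod H x -> V y ->
    (forall p, generated [set x] p -> V (p * y)) ->
    finite_set B -> B `<=` H -> H `<=` opgen B [set x; x^-1] ->
  fg_over H V.
Proof.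
move=> nH [VM HV VZ] Zx Vy Vpy finB0 B0H HE0.
have [gH HJ] := nH; have [H1 HM HVi] := gH.
have ZxV : central_mod H x^-1 by have [_ _] := central_mod_group nH; apply.
pose B1 := B `|` [set y ^ x * y^-1; y ^ x^-1 * y^-1].
have finB : finite_set B1 by rewrite finite_setU; split=> //; apply: finite_set2.
have BH : B1 `<=` H by move=> _ [/B0H//|[->|->]]; apply: central_comm.
have HE : H `<=` opgen B1 [set x; x^-1].
  by move=> h /HE0; apply: opgen_mono => // b; left.
have [X1 XM XV] := generated_group [set x].
have Xx : generated [set x] x by exact: sub_generated.
pose J F := generated [set b ^ f^-1 | f in F & b in B1].
have Jmono F F' : F `<=` F' -> J F `<=` J F'.
  move=> FF'; apply: generated_mono => _ [f Ff [b Bb <-]].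
  by exists f; [exact: FF'|exists b].
have HJx h : H h -> exists F, [/\ finite_set F, F `<=` generated [set x] & J F h].
  move=> /HE; apply: (@opgen_min _ _ _ [set h | exists F, [/\ _ F, _ & J F h]]).
  - split=> [|a b [F [finF FX Ja]] [F' [finF' F'X Jb]]|a [F [finF FX Ja]]].
    + by exists set0; split=> //; have [] :=
        generated_group [set b ^ f^-1 | f in set0 & b in B1].
    + exists (F `|` F'); split; first by rewrite finite_setU.
        by move=> f [/FX|/F'X].
      have [_ JM _] := generated_group [set b ^ f^-1 | f in F `|` F' & b in B1].
      by apply: JM; [apply: Jmono Ja|apply: Jmono Jb] => f; [left|right].
    + exists F; split=> //.
      by have [_ _] := generated_group [set b ^ f^-1 | f in F & b in B1]; apply.
  - move=> g a xg [F [finF FX Ja]].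
    have Xg : generated [set x] g by case: xg => ->; rewrite ?XV //; apply: XV.
    exists [set g * f | f in F]; split; first exact: finite_image.
      by move=> _ [f /FX Ff <-]; apply: XM.
    move: a Ja; apply: (generated_min (preimage_conj_group _ (generated_group _))).
    move=> _ [f Ff [b Bb <-]] /=; apply: sub_generated.
    exists (g * f); first by exists f.
    by exists b => //; rewrite invgM conjgM.
  - move=> b Bb; exists [set 1]; split; first exact: finite_set1.
      by move=> _ ->.
    by apply: sub_generated; exists 1 => //; exists b; rewrite ?invg1 ?conjg1.
have [F [finF FX FJ]] : exists F, [/\ finite_set F, F `<=` generated [set x] &
    forall b, B1 b -> J F (b ^ y)].
  apply: (@finite_uniform_set _ _ _ _ (fun F b => J F (b ^ y))) => //.
    by move=> F F' b FF'; apply: Jmono.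
  by move=> b /BH Hb; (apply: HJx; exact: HJ).
(* the factors in D absorb one more conjugation by x or by its inverse *)
pose D := [set 1; x; x^-1].
have DX e : D e -> generated [set x] e by move=> [[->|->]|->] //; apply: XV.
pose K := [set e * y * f | e in D & f in F].
exists B1, K; split=> //.
- by apply: finite_image2 => //; apply: finite_set3.
- move=> _ [e De [f Ff <-]].
  have -> : e * y * f = (e * f * y) * [~ y, f] by group_norm.
  apply: VM; last by apply: HV; apply: VZ.
  by apply: Vpy; apply: XM; [apply: DX|apply: FX].
set E := opgen B1 K; have gE : is_subgroup E by exact: opgen_group.
have ED e b : D e -> B1 b -> E (b ^ e^-1).
  move=> De Bb; have -> : b ^ e^-1 = (b ^ y) ^ (e * y)^-1 by group_norm.
  move: (b ^ y) (FJ _ Bb); apply: (generated_min (preimage_conj_group _ gE)).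
  move=> _ [f Ff [b' Bb' <-]] /=; rewrite -conjgM -invgM.
  by apply: opgen_closed; [exists e => //; exists f|apply: sub_opgen].
have Ea a : D a -> generated [set x] a -> B1 (y ^ a^-1 * y^-1) ->
    forall h, E h -> E (h ^ a^-1).
  move=> Da Xa Ba; apply: opgen_conj => //; first exact: opgen_closed.
    move=> _ [e De [f Ff <-]].
    have cX p : generated [set x] p -> p ^ a^-1 = p.
      move=> Xp; apply/conjg_fixP/commgP/commuteV/commute_sym.
      suff : generated [set x] `<=` [set q | commute q p] by apply.
      apply: generated_min => [|_ ->]; last exact: generated1_commute.
      split=> [|q r cq cr|q cq]; apply/commute_sym; first exact: commute1.
        by apply: commuteM; apply: commute_sym.
      exact/commuteV/commute_sym.
    rewrite 2!conjMg (cX e (DX _ De)) (cX f (FX _ Ff)).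
    have -> : e * y ^ a^-1 * f * (e * y * f)^-1 = (y ^ a^-1 * y^-1) ^ e^-1.
      by move: (y ^ a^-1) => z; group_norm.
    exact: ED.
  by move=> b Bb; apply: ED.
move=> h /HE; apply: opgen_min => //; last exact: sub_opgen.
move=> f a [->|->]; apply: Ea => //; first by left; right.
- by right; right.
- by right.
- exact: XV.
- by rewrite invgK; right; left.
Qed.

(** Along an edge path from [1] to [n] inside [V], the commutator of [t] with
    [n] is a product of conjugates, by the prefixes of the path, of the
    commutators of [t] with its steps. So if [E] is generated over [t] and these
    prefixes and contains the latter commutators, then [n], some conjugate of
    which by a power of [t] lies in [E], is itself in [E]. Applied to the
    conjugates by [t] of the generators, this makes [E] stable under conjugation
    by [t] and by [t^-1]. *)
Lemma coarsely_connected_fg_over H V t B : is_normal_subgroup H ->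
    central_monoid H V -> V t -> finite_set B -> B `<=` H ->
    H `<=` opgen B [set t; t^-1] -> coarsely_connected V ->
  fg_over H V.
Proof.
move=> nH [VM HV VZ] Vt finB0 B0H HE0 [_ [S [_ finS _ connS]]].
have [gH HJ] := nH; have [H1 HM HVi] := gH.
have gZ := central_mod_group nH; have [Z1 ZM ZV] := gZ.
have Zt := VZ _ Vt.
pose S' := S `&` central_mod H.
pose C := [set s ^ t^-1 * s^-1 | s in S'] `|` [set s ^ t * s^-1 | s in S'].
have finS' : finite_set S' by apply: finite_setIl.
have finC : finite_set C by rewrite finite_setU; split; apply: finite_image.
have CH : C `<=` H.
  by move=> _ [[s _ <-]|[s _ <-]]; apply: central_comm => //; apply: ZV.
pose steady X := forall E, is_subgroup E -> op_closed X E -> C `<=` E ->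
  forall x, X x -> E (x ^ t^-1 * x^-1) /\ E (x ^ t * x^-1).
pose reached y := exists X, [/\ finite_set X, X `<=` V, steady X & X y].
have extend X x s : steady X -> X x -> S' s ->
    steady (X `|` [set x * s]) /\ steady (X `|` [set x * s^-1]).
  move=> sX Xx S's; split=> E gE EX CE y [Xy|->].
  - by apply: sX => // f z Xf; apply: EX; left.
  - have [E1 EM EV] := gE.
    have EX' : op_closed X E by move=> f z Xf; apply: EX; left.
    have [Ex Ex'] := sX E gE EX' CE x Xx.
    have step a : E (x ^ a * x^-1) -> E (s ^ a * s^-1) ->
        E ((x * s) ^ a * (x * s)^-1).
      move=> ? ?; have -> : (x * s) ^ a * (x * s)^-1 =
        (x ^ a * x^-1) * (s ^ a * s^-1) ^ x^-1 by group_norm.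
      by apply: EM => //; apply: EX'.
    by split; apply: step => //; apply: CE; [left|right]; exists s.
  - by apply: sX => // f z Xf; apply: EX; left.
  - have [E1 EM EV] := gE.
    have EX' : op_closed X E by move=> f z Xf; apply: EX; left.
    have [Ex Ex'] := sX E gE EX' CE x Xx.
    set z := x * s^-1.
    have step a : E (x ^ a * x^-1) -> E (s ^ a * s^-1) -> E (z ^ a * z^-1).
      move=> ? ?; have -> : z ^ a * z^-1 =
        (x ^ a * x^-1) * ((s ^ a * s^-1) ^ z^-1)^-1 by rewrite /z; group_norm.
      by apply: EM => //; apply: EV; apply: EX => //; right.
    by split; apply: step => //; apply: CE; [left|right]; exists s.
have edge x y : cayley_edge_in S V x y -> reached x <-> reached y.
  move=> [Vx Vy [s Ss xy]].
  have S's : S' s.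
    split=> //; have -> : s = x^-1 * y by rewrite xy mulKg.
    by apply: ZM; [apply: ZV|]; apply: VZ.
  split=> [] [X [finX XV sX Xz]].
    exists (X `|` [set y]); split; last by right.
    - by rewrite finite_setU; split=> //; apply: finite_set1.
    - by move=> z [/XV//|->].
    - by rewrite xy; have [] := extend X x s sX Xz S's.
  exists (X `|` [set x]); split; last by right.
  - by rewrite finite_setU; split=> //; apply: finite_set1.
  - by move=> z [/XV//|->].
  - have -> : x = y * s^-1 by rewrite xy mulgK.
    by have [] := extend X y s sX Xz S's.
have reachedV y : V y -> reached y.
  move=> Vy; have : clos_refl_sym_trans G (cayley_edge_in S V) 1 y.
    by apply: connS => //; apply: HV.
  have reached1 : reached 1.
    exists [set 1]; split; [exact: finite_set1|by move=> _ ->; apply: HV| |by []].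
    by move=> E [E1 _ _] _ _ _ ->; rewrite !conj1g invg1 mulg1.
  move=> cxy; suff [/(_ reached1)] : reached 1 <-> reached y by [].
  elim: cxy => [x z /edge//|x|x z _ [? ?]|x z w _ [? ?] _ [? ?]] //; split; auto.
pose B1 := B `|` C.
have finB : finite_set B1 by rewrite finite_setU.
have BH : B1 `<=` H by move=> b [/B0H|/CH].
have /choice[W WP] b : exists X, B1 b ->
    [/\ finite_set X, X `<=` V, steady X & X (b ^ t)].
  have [/BH Hb|nBb] := pselect (B1 b); last by exists set0.
  by have [|X XP] := reachedV (b ^ t); [by apply: HV; apply: HJ|exists X].
pose F := [set t] `|` \bigcup_(b in B1) W b.
exists B1, F; split=> //.
- rewrite finite_setU; split; first exact: finite_set1.
  by apply: bigcup_finite => // b /WP[].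
- by move=> f [->|[b /WP[_ WV _ _] /WV]].
set E := opgen B1 F; have gE : is_subgroup E by exact: opgen_group.
have [E1 EM EV] := gE.
have Et x : E x -> E (x ^ t^-1) by apply: opgen_closed; left.
have EW b f : B1 b -> W b f -> E (f ^ t^-1 * f^-1) /\ E (f ^ t * f^-1).
  move=> Bb; have [_ _ sW _] := WP b Bb; apply: sW => //.
    by move=> g x Wg; apply: opgen_closed; right; exists b.
  by move=> c Cc; apply: sub_opgen; right.
have HL h : H h -> exists m, E (h ^ (t^-1 ^+ m)).
  have Eup m n x : (m <= n)%N -> E (x ^ (t^-1 ^+ m)) -> E (x ^ (t^-1 ^+ n)).
    by move=> mn Ex; rewrite -(subnKC mn) expgnDr conjgM; exact: conj_pow Et Ex.
  move=> /HE0; apply: (@opgen_min _ _ _ [set h | exists m, E (h ^ (t^-1 ^+ m))]).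
  - split=> [|x y [p Ex] [q Ey]|x [q Ex]].
    + by exists 0%N; rewrite conj1g.
    + exists (maxn p q); rewrite conjMg; apply: EM.
        exact: Eup (leq_maxl _ _) Ex.
      exact: Eup (leq_maxr _ _) Ey.
    + by exists q; rewrite conjVg; apply: EV.
  - move=> f x [->|->] [m Ex].
      by exists m; rewrite -conjgM -expgS expgSr conjgM; apply: Et.
    by exists m.+1; rewrite invgK expgS conjgM conjgK.
  - by move=> b Bb; exists 0%N; rewrite expg0 conjg1; apply: sub_opgen; left.
have EB b : B1 b -> E (b ^ t).
  move=> Bb; have [_ _ _ Wbt] := WP b Bb.
  have [m Em] := HL (b ^ t) (HJ _ t (BH _ Bb)).
  have [cbt _] := EW b _ Bb Wbt.
  have := EM _ _ (EV _ (comm_pow m gE Et cbt)) Em.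
  by rewrite invgM invgK mulgVK.
have EtV x : E x -> E (x ^ t).
  rewrite -[in X in _ -> X](invgK t).
  move: x; apply: opgen_conj => //; rewrite ?invgK //; first exact: opgen_closed.
  by move=> f [->|[b Bb /(EW b f Bb)[]//]]; rewrite conjgE mulKg mulgV.
move=> h /HE0; apply: opgen_min => // [f x [->|->]|b Bb].
- exact: Et.
- by rewrite invgK; apply: EtV.
- by apply: sub_opgen; left.
Qed.

End FgOver.

(** * A maximal half-space over which [H] is not finitely generated *)

Section Cone.
Variable G : groupType.
Implicit Types (H V : set G) (x y u : G).

Lemma generated1_zexpg x p : generated [set x] p -> exists i, p = zexpg x i.
Proof.
move=> xp; suff [m [n ->]] : exists m n, p = x ^+ m * x ^- n.
  have [le_nm|/ltnW le_mn] := leqP n m.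
    by exists (Posz (m - n)); rewrite /= expgnFr.
  have -> : x ^+ m * x ^- n = x ^- (n - m) by rewrite expgnFr // invgF.
  by case: (n - m)%N => [|k]; [exists (Posz 0); rewrite /= invg1|exists (Negz k)].
move: p xp; apply: generated_min => [|_ ->]; last first.
  by exists 1%N, 0%N; rewrite expg0 invg1 mulg1.
have cx m n : x ^- n * x ^+ m = x ^+ m * x ^- n.
  by apply/commute_sym/commuteV/commuteX2/commute_refl.
split=> [|p q [m [n ->]] [k [l ->]]|p [m [n ->]]].
- by exists 0%N, 0%N; rewrite expg0 mulgV.
- exists (m + k)%N, (l + n)%N; rewrite !expgnDr invgM !mulgA.
  by rewrite -[_ * _ * x ^+ k]mulgA cx !mulgA.
- by exists n, m; rewrite invgF.
Qed.

Lemma adjoin_central_monoid H V u : is_normal_subgroup H -> central_monoid H V ->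
  central_mod H u -> central_monoid H (adjoin V u).
Proof.
move=> nH [VM HV VZ] Zu; have gZ := central_mod_group nH; have [_ ZM _] := gZ.
split.
- move=> _ _ [v [n [Vv ->]]] [w [m [Vw ->]]].
  exists (v * (w * [~ w, u ^- n])), (n + m)%N; split.
    by apply: (VM) => //; apply: VM => //; apply: HV; apply: VZ.
  by rewrite expgnDr; group_norm.
- by move=> x /HV Vx; exists x, 0%N; rewrite expg0 mulg1.
- by move=> _ [v [n [/VZ Zv ->]]]; apply: ZM => //; exact: group_exp gZ Zu.
Qed.

(** [V] is a largest central monoid over which [H] is not finitely generated.
    Enlarging it by [u] or by [u^-1] restores finite generation, which is
    impossible for both by [fg_over_adjoin]; and [V] cannot contain both unless
    [H u], since [H] is finitely generated over the powers of such a [u]. The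
    same finite generation, with [fg_over_infinitesimal], excludes that some
    [y] in [V] dominates all powers of [x]. *)
Lemma exists_cone H (nH : is_normal_subgroup H) :
    finitely_generated [set: G] -> nilpotent_group (quot (NormalSubgroup nH)) ->
    maximal_not_fg H ->
  exists V, [/\ central_monoid H V,
    forall u, central_mod H u -> V u \/ V u^-1,
    forall u, V u -> V u^-1 -> H u,
    forall x y, V x -> ~ H x -> ~ (forall i, V (zexpg x i * y)) &
    ~ fg_over H V].
Proof.
move=> fgG nilH maxH; have [_ nfH _] := maxH; have [gH HJ] := nH.
have [H1 HM HV'] := gH; have gZ := central_mod_group nH.
pose P V := central_monoid H V /\ ~ fg_over H V.
have PH : P H.
  split; last by move=> /(fg_over_self gH).
  by split=> //; exact: sub_central_mod.
have [C C0 CP totC|V [[cV nfV] _ maxV]] := Zorn_above PH.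
  have [X0 CX0] := C0; split; first split.
  - move=> x y [X CX Xx] [Y CY Yy].
    have [XY|YX] := totC X Y CX CY; [exists Y|exists X] => //.
      by have [[YM _ _] _] := CP _ CY; apply: YM => //; apply: XY.
    by have [[XM _ _] _] := CP _ CX; apply: XM => //; apply: YX.
  - by have [[_ HX _] _] := CP _ CX0; move=> x Hx; exists X0 => //; apply: HX.
  - by move=> x [X CX Xx]; have [[_ _ XZ] _] := CP _ CX; apply: XZ.
  move=> [B [F [finB finF BH FC HE]]].
  have [Y CY FY] := chain_finite C0 totC finF FC.
  by have [_] := CP _ CY; apply; exists B, F.
have [VM HV VZ] := cV.
have adj u : central_mod H u -> ~ V u -> fg_over H (adjoin V u).
  move=> Zu nVu; apply: contrapT => nf; apply: nVu.
  apply: (maxV (adjoin V u)).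
  - by split=> //; apply: adjoin_central_monoid.
  - by move=> v Vv; exists v, 0%N; rewrite expg0 mulg1.
  - by exists 1, 1%N; rewrite expg1 mul1g; split=> //; apply: HV.
exists V; split=> //.
- move=> u Zu; apply: contrapT => nV; apply: nfV.
  have ZuV : central_mod H u^-1 by have [_ _] := gZ; apply.
  apply: (fg_over_adjoin nH cV Zu); apply: adj => // Vu; apply: nV; first by left.
  by right.
- move=> u Vu VuV; apply: contrapT => nHu; apply: nfV.
  have [B [finB BH HE]] := maximal_fg_over_cyclic maxH (VZ _ Vu) nHu.
  exists B, [set u; u^-1]; split=> //.
  by move=> _ [->|->].
- move=> x y Vx nHx Vxy; apply: nfV.
  have [B [finB BH HE]] := maximal_fg_over_cyclic maxH (VZ _ Vx) nHx.
  apply: (@fg_over_infinitesimal _ H V x y B) => //; first exact: VZ.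
    by have := Vxy (Posz 0); rewrite /= mul1g.
  by move=> p /generated1_zexpg[i ->].
Qed.

End Cone.

(** * Orders and quotients *)

Section InducedOrders.
Variables (G : groupType) (N : normalSubgroup G).
Notation pi := (@quot_proj G N).
Implicit Types (r : relation G) (rQ : relation (quot N)).

(** Invariance under antichain normal subgroups says the same as factorizing
    without mentioning an order on a quotient, and is easily transported along
    projections. *)
Definition absorbing (K : groupType) (r : relation K) :=
  forall (H : normalSubgroup K) g h k,
    antichain r H -> r g h -> nsg_set H k -> r (g * k) h.

Lemma pi_repr (u : quot N) : exists x, pi x = u.
Proof. by exists (repr u); exact: quot_reprK. Qed.

Lemma quot_proj_eq x y : pi x = pi y -> exists2 k, nsg_set N k & y = x * k.
Proof. by move=> /quot_projP Nxy; exists (x^-1 * y) => //; rewrite mulVKg. Qed.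

Lemma quot_zexpg x i : pi (zexpg x i) = zexpg (pi x) i.
Proof. by case: i => n; [exact: gmulfXn|exact: gmulfXVn]. Qed.

Lemma induced_is_order rQ : is_order (induced pi rQ) <-> is_order rQ.
Proof.
rewrite /induced; split=> [[irr asym tr ml mr]|[irr asym tr ml mr]]; split.
- by move=> u; have [x <-] := pi_repr u; apply: irr.
- by move=> u v; have [x <-] := pi_repr u; have [y <-] := pi_repr v; apply: asym.
- move=> u v w; have [x <-] := pi_repr u; have [y <-] := pi_repr v.
  by have [z <-] := pi_repr w; apply: tr.
- move=> u v w; have [x <-] := pi_repr u; have [y <-] := pi_repr v.
  by have [z <-] := pi_repr w; have := ml x y z; rewrite !gmulfM.
- move=> u v w; have [x <-] := pi_repr u; have [y <-] := pi_repr v.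
  by have [z <-] := pi_repr w; have := mr x y z; rewrite !gmulfM.
- by move=> x; apply: irr.
- by move=> x y; apply: asym.
- by move=> x y z; apply: tr.
- by move=> x y z xy; rewrite !gmulfM; apply: ml.
- by move=> x y z xy; rewrite !gmulfM; apply: mr.
Qed.

(** An order that is invariant under [N] on the left is so on the right, hence
    is induced by its restriction to representatives. *)
Lemma invariant_induced r : is_order r ->
    (forall g h k, r g h -> nsg_set N k -> r (g * k) h) ->
  exists2 rQ, is_order rQ & r = induced pi rQ.
Proof.
move=> or rN.
have [[_ _ NV] _] := nsg_normal N.
have rN' g h k : r g h -> nsg_set N k -> r g (h * k).
  move=> gh Nk; have := order_mulr or k (rN _ _ _ gh (NV _ Nk)).
  by rewrite mulgVK.
pose rQ (u v : quot N) := r (repr u) (repr v).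
have rE : r = induced pi rQ.
  apply/funext => g; apply/funext => h; apply/propext; rewrite /induced /rQ.
  have [k Nk Ek] := quot_proj_eq (quot_reprK (pi g)).
  have [l Nl El] := quot_proj_eq (quot_reprK (pi h)).
  split=> [|gh]; last by rewrite Ek El; apply: rN => //; apply: rN'.
  rewrite [in X in X -> _]Ek [in X in X -> _]El.
  move=> /rN/(_ (NV _ Nk)); rewrite mulgK.
  by move=> /rN'/(_ (NV _ Nl)); rewrite mulgK.
by exists rQ => //; apply/induced_is_order; rewrite -rE.
Qed.

End InducedOrders.

Lemma factorizingP (G : groupType) (r : relation G) : is_order r ->
  factorizing r <-> absorbing r.
Proof.
move=> or; split=> [fr H g h k aH gh Hk|ar H aH]; last first.
  by apply: invariant_induced => // g h k; apply: ar.
have [rQ _ rE] := fr H aH; move: gh; rewrite rE /induced gmulfM /=.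
by have /quot_proj1P -> := Hk; rewrite mulg1.
Qed.

Section TransferOrders.
Variables (G : groupType) (N : normalSubgroup G).
Notation pi := (@quot_proj G N).
Implicit Types (rQ : relation (quot N)).

Lemma preimage_normal (H : normalSubgroup (quot N)) :
  is_normal_subgroup [set x | nsg_set H (pi x)].
Proof.
have [[H1 HM HV] HJ] := nsg_normal H.
split; first split=> [|x y Hx Hy|x Hx] /=; rewrite ?gmulfM ?gmulfV //.
- exact: HM.
- exact: HV.
- by move=> x y Hx; rewrite /= gmulfJ; apply: HJ.
Qed.

Lemma image_normal (H : normalSubgroup G) :
  is_normal_subgroup [set pi x | x in nsg_set H].
Proof.
have [[H1 HM HV] HJ] := nsg_normal H.
split; first split=> [|_ _ [x Hx <-] [y Hy <-]|_ [x Hx <-]].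
- by exists 1; rewrite ?gmulf1.
- by exists (x * y); rewrite ?gmulfM //; apply: HM.
- by exists x^-1; rewrite ?gmulfV //; apply: HV.
- move=> _ v [x Hx <-]; have [y <-] := pi_repr v.
  by exists (x ^ y); rewrite ?gmulfJ //; apply: HJ.
Qed.

Lemma absorbing_induced rQ : absorbing (induced pi rQ) <-> absorbing rQ.
Proof.
split=> [ar H u v w aH uv Hw|ar H g h k aH gh Hk].
  have [x xu] := pi_repr u; have [y yv] := pi_repr v; have [z zw] := pi_repr w.
  have := ar (NormalSubgroup (preimage_normal H)) x y z.
  rewrite /induced gmulfM /= xu yv zw; apply=> //.
  by move=> s t Hs Ht; apply: aH.
rewrite /induced gmulfM /=.
apply: (ar (NormalSubgroup (image_normal H))) => //=; last by exists k.
by move=> _ _ [s Hs <-] [t Ht <-]; apply: aH.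
Qed.

Lemma nontrivial_full_archimedean_induced rQ :
  nontrivial_full_archimedean (induced pi rQ) <-> nontrivial_full_archimedean rQ.
Proof.
split=> [[or nt [pr fr] ar]|[or nt [pr fr] ar]].
  have oQ : is_order rQ by apply/induced_is_order.
  split=> //.
  - by move=> tQ; apply: nt => g h; apply: tQ.
  - split; last exact/(factorizingP oQ)/absorbing_induced/(factorizingP or).
    move=> u v n; have [x <-] := pi_repr u; have [y <-] := pi_repr v.
    by rewrite -!gmulfXn; apply: pr.
  - move=> [u [v []]]; have [x <-] := pi_repr u; have [y <-] := pi_repr v.
    move=> x1 xy; apply: ar; exists x, y; split; first by rewrite /induced gmulf1.
    by move=> i; have := xy i; rewrite -quot_zexpg.
have oG : is_order (induced pi rQ) by apply/induced_is_order.
split=> //.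
- move=> tG; apply: nt => u v; have [x <-] := pi_repr u.
  by have [y <-] := pi_repr v; apply: tG.
- split; last exact/(factorizingP oG)/absorbing_induced/(factorizingP or).
  by move=> x y n; rewrite /induced !gmulfXn; apply: pr.
- move=> [x [y [x1 xy]]]; apply: ar; exists (pi x), (pi y).
  split; first by move: x1; rewrite /induced gmulf1.
  by move=> i; have := xy i; rewrite /induced /= quot_zexpg.
Qed.

End TransferOrders.

(** * Orders with central positive cone *)

Section ConeOrder.
Variables (P : groupType) (W : set P).
Hypotheses (nilP : nilpotent_group P) (W1 : W 1)
  (WM : forall x y, W x -> W y -> W (x * y))
  (WZ : W `<=` central_mod [set 1])
  (Wtotal : forall z, central_mod [set 1] z -> W z \/ W z^-1)
  (Wpointed : forall z, W z -> W z^-1 -> z = 1)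
  (Warch : forall x y, W x -> x <> 1 -> ~ (forall i, W (zexpg x i * y)))
  (Wnontrivial : exists2 x, W x & x <> 1).

Definition cone_order : relation P := fun g h => W (g^-1 * h) /\ g <> h.

Lemma cone_exp x n : W x -> W (x ^+ n).
Proof.
by move=> Wx; elim: n => [|n IHn]; rewrite ?expg0 // expgS; apply: WM.
Qed.

Lemma cone_conj x y : W x -> x ^ y = x.
Proof. by move=> /WZ/(_ y) /= xy; apply/conjg_fixP/eqP. Qed.

Lemma cone_torsionfree (z : P) n : central_mod [set 1] z -> (0 < n)%N -> z ^+ n = 1 ->
  z = 1.
Proof.
case: n => // n Zz _ zn.
have tf x : W x -> x ^+ n.+1 = 1 -> x = 1.
  move=> Wx xn; apply: Wpointed => //; suff -> : x^-1 = x ^+ n by apply: cone_exp.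
  by apply: mulg1_eq; rewrite -expgS.
have [/tf->//|/tf zV] := Wtotal Zz.
by apply/invg_inj; rewrite invg1; apply: zV; rewrite expVgn zn invg1.
Qed.

Lemma cone_order_is_order : is_order cone_order.
Proof.
split.
- by move=> g [].
- move=> g h [Wgh gh] [Whg _]; apply: gh; apply/esym/divg1_eq.
  have : g^-1 * h = 1 by apply: Wpointed => //; rewrite invgM invgK.
  by move=> /mulg1_eq; rewrite invgK => ->; rewrite mulgV.
- move=> f g h [Wfg fg] [Wgh gh]; split.
    by have := WM Wfg Wgh; rewrite mulgA mulgK.
  move=> fh; apply: gh; rewrite -fh in Wgh *.
  have : f^-1 * g = 1 by apply: Wpointed => //; rewrite invgM invgK.
  by move=> /mulg1_eq; rewrite invgK.
- move=> f g h [Wfg fg]; split; last by move/mulgI.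
  by rewrite invgM mulgA mulgVK.
- move=> f g h [Wfg fg]; split; last by move/mulIg.
  by rewrite invgM -mulgA [f^-1 * _]mulgA -conjgE cone_conj.
Qed.

(** A nontrivial normal subgroup contains a nontrivial central element, which is
    comparable to [1]. *)
Lemma cone_antichain (H : normalSubgroup P) : antichain cone_order H ->
  forall x, nsg_set H x -> x = 1.
Proof.
move=> aH; have [[H1 HM HV] _] := nsg_normal H.
apply: (nilpotent_normal_center nilP (nsg_normal H)) => z Hz Zz.
apply: contrapT => z1; have [Wz|Wz] := Wtotal Zz.
  apply: (aH 1 z) => //; split; last exact/nesym.
  by rewrite invg1 mul1g.
by apply: (aH z 1) => //; split=> //; rewrite mulg1.
Qed.

Lemma cone_order_full_archimedean : nontrivial_full_archimedean cone_order.
Proof.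
have oW := cone_order_is_order.
split=> //.
- move=> tW; have [x Wx x1] := Wnontrivial; apply: (tW 1 x); split; last exact/nesym.
  by rewrite invg1 mul1g.
- split; last first.
    apply/(factorizingP oW) => H g h k aH gh Hk.
    by rewrite (cone_antichain aH Hk) mulg1.
  move=> g h n [Wgh ghn].
  have n0 : (0 < n)%N by case: n ghn {Wgh}.
  have Zc := central_root cone_torsionfree nilP n0 (WZ Wgh).
  split; last by move=> gh; apply: ghn; rewrite gh.
  have [//|Wc] := Wtotal Zc.
  have hE : h ^+ n = g ^+ n * (g^-1 * h) ^+ n.
    rewrite -expgMn ?mulVKg //; apply/commute_sym/commgP/eqP; exact: Zc.
  case: ghn; have : (g ^+ n)^-1 * h ^+ n = 1.
    apply: Wpointed => //; rewrite hE mulKg -expVgn; exact: cone_exp.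
  by move=> /mulg1_eq; rewrite invgK.
- move=> [g [h [[Wg g1] gh]]]; rewrite invg1 mul1g in Wg.
  apply: (@Warch g h) => // [|i]; first exact/nesym.
  have [] : cone_order (zexpg g (- i)%R) h by [].
  suff -> : (zexpg g (- i)%R)^-1 = zexpg g i by [].
  by case: i => [[|n]|n] /=; rewrite ?invg1 ?invgK.
Qed.

End ConeOrder.

(** * Positive elements are central *)

Section PositiveCentral.
Variables (P : groupType) (r : relation P).
Hypotheses (nilP : nilpotent_group P) (or : is_order r) (pr : primitive r)
  (ar : archimedean r)
  (antichain1 : forall H : normalSubgroup P, antichain r H ->
     forall x, nsg_set H x -> x = 1).
Implicit Types (x y z a b c h u : P) (s t : seq P) (m n : nat).
Notation center := (central_mod [set 1 : P]).

Lemma center_group : is_subgroup center.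
Proof. exact: central_mod_group (upper_central_normal P 0). Qed.

Lemma center_conj z y : center z -> z ^ y = z.
Proof. by move=> /(_ y) /= zy; apply/conjg_fixP/eqP. Qed.

Lemma center_commute z y : center z -> commute z y.
Proof. by move=> /(_ y) /= zy; apply/commgP/eqP. Qed.

(** The subgroup generated by [z] is normal, hence not an antichain. *)
Lemma center_total z : center z -> z <> 1 -> r 1 z \/ r z 1.
Proof.
move=> Zz z1; have nH : is_normal_subgroup (generated [set z]).
  apply: generated_normal => _ y ->; rewrite center_conj //.
  exact: sub_generated.
have [_ HM HV] := generated_group [set z].
have [aH|] := pselect (antichain r (NormalSubgroup nH)).
  by case: z1; apply: (antichain1 aH); apply: sub_generated.
move=> /existsNP[a /existsNP[b /not_implyP[Ha /not_implyP[Hb /contrapT ab]]]].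
have := order_mull or a^-1 ab; rewrite mulVg.
have /generated1_zexpg[[n|n] ->] : generated [set z] (a^-1 * b).
  by apply: HM => //; apply: HV.
- by left; apply: (pr (n := n)); rewrite expg1n.
- move=> /(order_mull or (z ^+ n.+1)); rewrite /= mulgV mulg1 => zn.
  by right; apply: (pr (n := n.+1)); rewrite expg1n.
Qed.

(** Squaring [u * x] turns the product of two conjugates of [x] into a power,
    to which primitivity applies. *)
Lemma half_of_conj_pair z x u : center z -> r (z ^+ 2) (x ^ u * x) -> r z x.
Proof.
move=> Zz /(order_mull or (u * u)) zx.
have /pr/(order_mull or u^-1) : r ((u * z) ^+ 2) ((u * x) ^+ 2).
  rewrite [X in r X _](_ : _ = u * u * z ^+ 2); last first.
    by rewrite expgMn ?expg2 //; apply/commute_sym/center_commute.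
  by rewrite [X in r _ X](_ : _ = u * u * (x ^ u * x)) // expg2; group_norm.
by rewrite !mulKg.
Qed.

Lemma center_comm_exp c y m : center [~ c, y] -> [~ c, y ^+ m] = [~ c, y] ^+ m.
Proof.
move=> Zz; elim: m => [|m IHm]; first by rewrite !expg0 commg1.
rewrite expgSr [RHS]expgS.
have -> : [~ c, y ^+ m * y] = [~ c, y] * [~ c, y ^+ m] ^ y by group_norm.
by rewrite IHm conjXg center_conj.
Qed.

Variable g : P.
Hypothesis g_pos : r 1 g.

Notation conj_prod s := (\prod_(a <- s) g ^ a).

Lemma conj_prod_conj s u : conj_prod s ^ u = conj_prod [seq a * u | a <- s].
Proof. by rewrite conjg_prod big_map; apply: eq_bigr => a _; rewrite conjgM. Qed.

Definition conj_ratio n x := exists s t,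
  [/\ size s = n, size t = n & x = (conj_prod t)^-1 * conj_prod s].

Lemma conj_ratio_comm1 y : conj_ratio 1 [~ g, y].
Proof.
exists [:: y], [:: 1]; split=> //.
by rewrite !big_cons !big_nil !mulg1 conjg1.
Qed.

(** If [c = v^-1 * u] then [(v ^ h * u)^-1 * (u ^ h * v)] is the commutator of
    [c] with [h * v], and [h] is arbitrary. *)
Lemma conj_ratio_comm n c y : conj_ratio n c -> conj_ratio (n + n) [~ c, y].
Proof.
move=> [s [t [sn tn ->]]]; set v := conj_prod t; set u := conj_prod s.
exists ([seq a * (y * v^-1) | a <- s] ++ t), ([seq a * (y * v^-1) | a <- t] ++ s).
rewrite !size_cat !size_map sn tn; split=> //.
rewrite !big_cat /= -!conj_prod_conj -/u -/v.
by group_norm.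
Qed.

Lemma conj_prod_lower z a b s : center z -> r z g -> r a b ->
  r (a * z ^+ size s) (b * conj_prod s).
Proof.
move=> Zz zg; elim: s a b => [|x s IHs] a b ab.
  by rewrite big_nil expg0 !mulg1.
rewrite big_cons /= expgS [a * _]mulgA [b * _]mulgA; apply: IHs.
apply: (order_trans or (order_mulr or z ab)); apply: (order_mull or b).
rewrite -(center_conj x Zz).
exact: (order_mull or _ (order_mulr or x zg)).
Qed.

(** Doubling [x] into [x ^ u * x] with [u] chosen so that the prescribed next
    factor appears, a product of [n] conjugates of [g] becomes the beginning of
    a product of [2 ^ n] conjugates whose size controls that of [g]. *)
Lemma conj_prod_extend s : exists s', (size s + size s' = 2 ^ size s)%N /\
  forall z, center z -> r (z ^+ (2 ^ size s)) (conj_prod s * conj_prod s') -> r z g.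
Proof.
elim: s => [|a s [s' [ss' sP]]].
  exists [:: 1]; split=> // z _; rewrite big_nil big_cons big_nil.
  by rewrite conjg1 mulg1 mul1g expg1.
case E : (s ++ s') => [|b s''].
  by have := expn_gt0 2 (size s); rewrite -ss' -size_cat E.
pose u := b^-1 * a; exists ([seq d * (u * conj_prod s) | d <- s''] ++ s'); split.
  have s2 : (size s'').+1 = (2 ^ size s)%N by rewrite -ss' -size_cat E.
  by rewrite size_cat size_map /= expnS mul2n -addnn -{1}s2 -ss' !addSn addnCA.
move=> z Zz zx; apply: (sP) => //.
apply: (half_of_conj_pair (u := u)); first exact: group_exp center_group Zz.
rewrite -expgnA mulnC -expnS; move: zx; congr (r _ _).
have xE : conj_prod s * conj_prod s' = g ^ b * conj_prod s''.
  by rewrite -big_cat E big_cons.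
rewrite [in X in _ = X ^ u * _]xE big_cons big_cat -conj_prod_conj /u.
by group_norm.
Qed.

(** The length [n] does not depend on [y], so the ratio can be taken to be the
    power [2 ^ n] of [[~ c, y]], large enough to survive the passage to products
    of [2 ^ n] conjugates in [conj_prod_extend]. *)
Lemma central_ratio_lower n c y z : (0 < n)%N ->
    (forall y, conj_ratio n [~ c, y]) -> center [~ c, y] -> r 1 [~ c, y] ->
  center z -> r z g -> r (z * [~ c, y]) g.
Proof.
set d := [~ c, y] => n0 dc Zd d1 Zz zg.
have [s [t [sn tn st]]] := dc (y ^+ (2 ^ n)).
move: st; rewrite center_comm_exp // -/d => st.
have [s' [ss' sP]] := conj_prod_extend s.
have Zzd : center (z * d) by have [_ ZM _] := center_group; apply: ZM.
apply: sP => //; rewrite sn.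
have tz : r (z ^+ n) (conj_prod t).
  case: t tn {st} => [|a t] tn; first by rewrite -tn in n0.
  rewrite -tn /= expgS big_cons; apply: conj_prod_lower => //.
  rewrite -(center_conj a Zz).
  exact: (order_mull or _ (order_mulr or a zg)).
have := conj_prod_lower s' Zz zg (order_mulr or (d ^+ (2 ^ n)) tz).
have <- : conj_prod s = conj_prod t * d ^+ (2 ^ n) by rewrite st mulVKg.
congr (r _ _).
rewrite (expgMn _ (center_commute d Zz)).
rewrite -[in z ^+ (2 ^ n)]sn -ss' sn expgnDr -!mulgA; congr (_ * _).
by apply: commuteX2; apply: center_commute.
Qed.

Lemma exists_central_ratio : ~ center g -> exists n c,
  [/\ (0 < n)%N, forall y, conj_ratio n [~ c, y],
      forall y, center [~ c, y] & ~ center c].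
Proof.
have center_sub i : center `<=` upper_central i.+1.
  elim: i => // i IHi x /IHi Ux h.
  exact: (sub_central_mod (upper_central_normal P i) (Ux h)).
suff find i c n : (0 < n)%N -> (forall y, conj_ratio n [~ c, y]) ->
    upper_central i.+2 c -> ~ center c -> exists n c,
  [/\ (0 < n)%N, forall y, conj_ratio n [~ c, y],
      forall y, center [~ c, y] & ~ center c].
  have [i Ui] := nilpotent_upper_central nilP.
  apply: (find i g 1%N) => //; first exact: conj_ratio_comm1.
  apply: (sub_central_mod (upper_central_normal P i.+1)).
  exact: (sub_central_mod (upper_central_normal P i)).
elim: i c n => [|i IHi] c n n0 dc Uc nZc; first by exists n, c.
have [Uc'|] := pselect (upper_central i.+2 c); first exact: IHi n0 dc Uc' nZc.
move=> /existsNP[y nUy]; apply: (IHi [~ c, y] (n + n)%N).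
- by rewrite addn_gt0 n0.
- by move=> y'; apply: conj_ratio_comm.
- exact: Uc.
- by move/(@center_sub i).
Qed.

(** Otherwise some central [z > 1] is, together with all its powers, a ratio of
    two products of conjugates of [g] of a fixed length, so that every central
    lower bound of [g] can be multiplied by [z]: [g] would dominate all powers
    of [z]. *)
Lemma positive_central : center g.
Proof.
apply: contrapT => /exists_central_ratio[n [c [n0 dc Zc nZc]]].
have [y ncy] : exists y, [~ c, y] <> 1 by apply/existsNP => cc; apply: nZc.
have [y' y'1] : exists y', r 1 [~ c, y'].
  have [|zpos] := center_total (Zc y) ncy; first by exists y.
  exists y^-1; have -> : [~ c, y^-1] = [~ c, y]^-1.
    by rewrite -(center_conj y^-1 (Zc y)); group_norm.
  by have := order_mull or [~ c, y]^-1 zpos; rewrite mulVg mulg1.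
set z := [~ c, y'] in y'1.
have Zz m : center (z ^+ m) by apply: group_exp center_group _; apply: Zc.
have low m : r (z ^+ m) g.
  elim: m => [|m IHm]; first by rewrite expg0.
  by rewrite expgSr; apply: (central_ratio_lower n0).
have zpos m : r 1 (z ^+ m.+1).
  elim: m => [|m IHm] //; apply: (order_trans or IHm).
  by have := order_mulr or (z ^+ m.+1) y'1; rewrite mul1g -expgS.
apply: ar; exists z, g; split=> // -[m|m] /=; first exact: low.
apply: (order_trans or _ g_pos).
by have := order_mull or (z ^- m.+1) (zpos m); rewrite mulVg mulg1.
Qed.

End PositiveCentral.

(** * Connected half-spaces *)

(** Modulo [K] the ambient group [central_mod K] is commutative, so that a word
    can be reordered to begin with all its letters in [V]; its prefixes then
    first increase and afterwards decrease to the endpoint, staying in [V]. *)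
Lemma central_monoid_coarsely_connected (G : groupType) (K V : set G) :
    is_normal_subgroup K -> central_monoid K V ->
    (forall u, central_mod K u -> V u \/ V u^-1) ->
    finitely_generated K -> finitely_generated (central_mod K) ->
  coarsely_connected V.
Proof.
move=> nK [VM KV VZ] Vtot [SK finSK SKE] [SM finSM SME].
have [gK KJ] := nK; have gM := central_mod_group nK; have [M1 MM MV] := gM.
have V1 : V 1 by have [K1 _ _] := gK; exact: KV.
pose S := SM `|` SK; exists (central_mod K), S; split=> //.
- by rewrite finite_setU.
- apply/seteqP; split.
    apply: generated_min => // x [SMx|SKx].
      by rewrite -SME; apply: sub_generated.
    by apply: VZ; apply: KV; rewrite -SKE; apply: sub_generated.
  by rewrite -SME; apply: generated_mono => x; left.
pose conn := clos_refl_sym_trans G (cayley_edge_in S V).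
pose Y := [set q | V q /\ forall p, V p -> conn p (p * q)].
have Y1 : Y 1 by split=> // p Vp; rewrite mulg1; apply: rst_refl.
have YM p q : Y p -> Y q -> Y (p * q).
  move=> [Vp cp] [Vq cq]; split=> [|a Va]; first exact: VM.
  rewrite mulgA; apply: rst_trans (cp a Va) _.
  by apply: cq; apply: VM.
have YS s : S s -> V s -> Y s.
  move=> Ss Vs; split=> // p Vp; apply: rst_step.
  by split=> //; [exact: VM|exists s].
have YSV s : S s -> V s^-1 -> Y s^-1.
  move=> Ss Vs; split=> // p Vp; apply: rst_sym; apply: rst_step.
  by split=> //; [exact: VM|exists s; rewrite ?mulgVK].
have YK : K `<=` Y.
  suff : K `<=` [set q | [/\ K q, Y q & Y q^-1]] by move=> KY q /KY[].
  rewrite -SKE; apply: generated_min; rewrite SKE.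
    have [K1 KM KV'] := gK.
    split=> [|p q [Kp Yp Ypi] [Kq Yq Yqi]|p [Kp Yp Ypi]].
    + by rewrite /= invg1.
    + by split; rewrite ?invgM; [exact: KM|exact: YM|exact: YM].
    + by split; rewrite ?invgK //; exact: KV'.
  move=> s Ss; have Ks : K s by rewrite -SKE; apply: sub_generated.
  split=> //; first by apply: YS; [right|exact: KV].
  by apply: YSV; [right|apply: KV; have [_ _] := gK; apply].
have MY : central_mod K `<=` [set x | central_mod K x /\ exists2 q, Y q & Y (x * q)].
  rewrite -SME; apply: generated_min; rewrite SME.
    split=> [|x y [Mx [p Yp Yxp]] [My [q Yq Yyq]]|x [Mx [p Yp Yxp]]].
    + by split=> //; exists 1; rewrite ?mulg1.
    + split; first exact: MM.
      exists (p * q); first exact: YM.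
      have -> : x * y * (p * q) = x * p * (y * q) * [~ y, p] ^ q by group_norm.
      by apply: (YM); [exact: YM|apply: YK; apply: KJ; apply: My].
    + by split; [exact: MV|exists (x * p); rewrite ?mulKg].
  move=> s Ss; have Ms : central_mod K s by rewrite -SME; apply: sub_generated.
  split=> //; have [Vs|Vs] := Vtot s Ms.
    by exists 1 => //; rewrite mulg1; apply: YS => //; left.
  by exists s^-1; rewrite ?mulgV //; apply: YSV => //; left.
have connV x : V x -> conn x 1.
  move=> Vx; have [_ [q [_ cq] [_ cxq]]] := MY x (VZ x Vx).
  apply: rst_trans (cq x Vx) _; apply: rst_sym.
  by have := cxq 1 V1; rewrite mul1g.
by move=> x y /connV cx /connV cy; apply: rst_trans cx (rst_sym _ _ _ _ cy).
Qed.

(** * Orders induced from [G / N] and finite generation of [N] *)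

Lemma upper_set_normal (G : groupType) (K : normalSubgroup G)
    (rK : relation (quot K)) g :
  upper_set (induced (@quot_proj _ K) rK) K g <->
  rK 1 (quot_proj K g) \/ quot_proj K g = 1.
Proof.
have [[K1 _ _] _] := nsg_normal K.
split=> [[k Kk [kg|->]]|[g1|/quot_proj1P Kg]].
- by left; have /quot_proj1P <- := Kk.
- by right; apply/quot_proj1P.
- by exists 1 => //; left; rewrite /induced gmulf1.
- by exists g => //; right.
Qed.

(** An order on the quotient by a maximal antichain has central positive
    elements; its upper set is a half-space as above. *)
Lemma S_ord_sub_Sigma1 (G : groupType) (N : normalSubgroup G) :
    finitely_generated [set: G] -> nilpotent_group (quot N) ->
    finitely_generated N -> S_ord N `<=` @Sigma1_ord G.
Proof.
move=> fgG nilN fgN _ [rQ nfaQ <-].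
have nfa : nontrivial_full_archimedean (induced (@quot_proj _ N) rQ).
  exact/nontrivial_full_archimedean_induced.
split=> // K [aK maxK].
have [_ _ [_ fr] _] := nfa.
have [rK oK rKE] := fr K aK.
have nfaK : nontrivial_full_archimedean rK.
  by apply/nontrivial_full_archimedean_induced; rewrite -rKE.
rewrite rKE in aK maxK *.
have antichain1 (H : normalSubgroup (quot K)) : antichain rK H ->
    forall u, nsg_set H u -> u = 1.
  move=> aH u Hu; have [x xu] := pi_repr u; rewrite -xu.
  apply/quot_proj1P; apply: (maxK (NormalSubgroup (preimage_normal H))).
  - by move=> s t Hs Ht; apply: aH.
  - have [[H1 _ _] _] := nsg_normal H.
    by move=> k /quot_proj1P Kk; rewrite /= Kk.
  - by rewrite /= xu.
have NK : N `<=` K.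
  move=> n Nn; apply/quot_proj1P.
  apply: (antichain1 (NormalSubgroup (image_normal K N))); last by exists n.
  move=> _ _ [s Ns <-] [t Nt <-] st.
  have : induced (@quot_proj _ K) rK s t by [].
  rewrite -rKE /induced /=.
  have /quot_proj1P -> := Ns; have /quot_proj1P -> := Nt.
  by have [oQ _ _ _] := nfaQ; apply: order_irrefl oQ _.
have nilK := nilpotent_quot_sub NK nilN.
have [_ ntK [prK _] arK] := nfaK.
have nK := nsg_normal K; have [[_ KM KV] KJ] := nK.
have posZ u : rK 1 u -> central_mod [set 1] u.
  exact: (positive_central nilK oK prK arK antichain1).
pose V := upper_set (induced (@quot_proj _ K) rK) K.
have VE g : V g <-> rK 1 (quot_proj K g) \/ quot_proj K g = 1.
  exact: upper_set_normal.
have oneV u : rK 1 u \/ u = 1 -> forall w, rK 1 w \/ w = 1 ->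
    rK 1 (u * w) \/ u * w = 1.
  move=> [u1|->] w; last by rewrite mul1g.
  move=> [w1|->]; last by rewrite mulg1; left.
  left; apply: (order_trans oK u1).
  by have := order_mull oK u w1; rewrite mulg1.
apply: (central_monoid_coarsely_connected nK).
- split.
  + by move=> x y /VE Vx /VE Vy; apply/VE; rewrite gmulfM; apply: oneV.
  + by move=> k /quot_proj1P Kk; apply/VE; right.
  + move=> g /VE[/posZ/central_quot//|/quot_proj1P Kg].
    exact: sub_central_mod.
- move=> u /central_quot Zu.
  have [u1|u1] := pselect (quot_proj K u = 1); first by left; apply/VE; right.
  have [upos|uneg] := center_total oK prK antichain1 Zu u1.
    by left; apply/VE; left.
  right; apply/VE; left; rewrite gmulfV /=.
  by have := order_mull oK (quot_proj K u)^-1 uneg; rewrite mulVg mulg1.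
- exact: (fg_normal_over fgG nilN fgN).
- apply: (fg_normal_over fgG nilN fgN); first exact: central_mod_normal.
  by move=> n /NK; apply: sub_central_mod.
Qed.

(** The half-space [V] over which a maximal non-finitely-generated [H] fails to
    be finitely generated is the upper set of an order in [S_ord N]. *)
Lemma Sigma1_finitely_generated (G : groupType) (N : normalSubgroup G) :
    finitely_generated [set: G] -> nilpotent_group (quot N) ->
    S_ord N `<=` @Sigma1_ord G -> finitely_generated N.
Proof.
move=> fgG nilN sub; apply: contrapT => nfN.
have [H maxH NH] := exists_maximal_not_fg (nsg_normal N) nfN.
have [nH nfH _] := maxH; have [[H1 HM HV'] HJ] := nH.
pose HH := NormalSubgroup nH.
have nilH : nilpotent_group (quot HH) by apply: nilpotent_quot_sub nilN.
have [V [cV Vtot Vpt Varch nfV]] := exists_cone fgG nilH maxH.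
have [VM HV VZ] := cV.
have [t0 Zt0 nHt0] := maximal_not_fg_central fgG nilH nfH.
have [t Vt nHt] : exists2 t, V t & ~ H t.
  have [Vt|Vt] := Vtot _ Zt0; first by exists t0.
  by exists t0^-1 => // /HV'; rewrite invgK.
pose pi := @quot_proj G HH.
have piH x : pi x = 1 <-> H x by exact: quot_proj1P.
pose W : set (quot HH) := [set pi x | x in V].
have WE x : W (pi x) <-> V x.
  split=> [[y Vy /quot_proj_eq[k Hk ->]]|Vx]; last by exists x.
  by apply: VM => //; apply: HV.
have W1 : W 1 by exists 1; [exact: HV|exact: gmulf1].
have WM u w : W u -> W w -> W (u * w).
  have [x <-] := pi_repr u; have [y <-] := pi_repr w.
  by move=> /WE Vx /WE Vy; rewrite -gmulfM; apply/WE/VM.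
have WZ : W `<=` central_mod [set 1].
  by move=> _ [x /VZ Zx <-]; apply/central_quot.
have Wtot u : central_mod [set 1] u -> W u \/ W u^-1.
  have [x <-] := pi_repr u => /central_quot/Vtot[Vx|Vx]; [left|right].
    exact/WE.
  by rewrite -gmulfV; apply/WE.
have Wpt u : W u -> W u^-1 -> u = 1.
  have [x <-] := pi_repr u; rewrite -gmulfV => /WE Vx /WE VxV.
  by apply/piH/Vpt.
have Warch u w : W u -> u <> 1 -> ~ (forall i, W (zexpg u i * w)).
  have [x <-] := pi_repr u; have [y <-] := pi_repr w.
  move=> /WE Vx /piH nHx Wxy; apply: (Varch x y Vx nHx) => i.
  by apply/WE; rewrite /pi gmulfM /= quot_zexpg; apply: Wxy.
have Wnt : exists2 u, W u & u <> 1 by exists (pi t); [exact/WE|move/piH].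
have nfaW := cone_order_full_archimedean nilH W1 WM WZ Wtot Wpt Warch Wnt.
pose r := induced pi (cone_order W).
have nfa : nontrivial_full_archimedean r.
  exact/nontrivial_full_archimedean_induced.
have or : is_order r by have [] := nfa.
have irr : forall u, ~ cone_order W u u by move=> u [].
have [rN _ rNE] : exists2 rN, is_order rN & r = induced (@quot_proj _ N) rN.
  apply: invariant_induced => // g h k gh /NH Hk.
  rewrite /r /induced gmulfM /= (_ : quot_proj HH k = 1) ?mulg1 //.
  exact/piH.
have [|_ /(_ HH)] := sub r.
  exists rN; last by rewrite -rNE.
  by apply/nontrivial_full_archimedean_induced; rewrite -rNE.
have maxA : maximal_antichain_normal r HH.
  split=> [s s' Hs Hs'|K aK HK k Kk].
    have /piH s1 := Hs; have /piH s1' := Hs'.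
    by rewrite /r /induced /= -/pi s1 s1'; apply: irr.
  pose piK := NormalSubgroup (image_normal HH K).
  apply/piH; apply: (@cone_antichain _ W nilH Wtot piK).
    by move=> _ _ [a Ka <-] [b Kb <-]; apply: aK.
  by exists k.
move=> /(_ maxA); suff -> : upper_set r HH = V.
  have [B [finB BH HE]] := maximal_fg_over_cyclic maxH (VZ _ Vt) nHt.
  by move=> ccV; apply: nfV; apply: (coarsely_connected_fg_over nH cV Vt finB BH HE).
apply/seteqP; split=> g.
  move=> /upper_set_normal[[]|/piH/HV//]; rewrite invg1 mul1g => /WE//.
move=> Vg; apply/upper_set_normal.
have [g1|g1] := pselect (pi g = 1); [by right|left].
by split; [rewrite invg1 mul1g; apply/WE|exact/nesym].
Qed.

Theorem theorem1 (G : groupType) (N : normalSubgroup G)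
    (fgG : finitely_generated [set: G]) (nilQ : nilpotent_group (quot N)) :
  finitely_generated N <-> S_ord N `<=` @Sigma1_ord G.
Proof.
split; first exact: S_ord_sub_Sigma1.
exact: Sigma1_finitely_generated.
Qed.
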